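(* Let $2\le n<\infty$ and let $$\Lambda:=\ell^2_1\cup\{(0,\ldots,0,c)\in\mathbb{C}^n:|c|=1\}$$ (disjoint union). For $v\in\Lambda$ let $\omega^{v}$ be the geometric progression state $\omega'_v$ of order $\infty$ on $\mathcal{O}_n$ by $v$ if $v\in\ell^2_1$, and the Cuntz state on $\mathcal{O}_n$ by $v$ if $v=(0,\ldots,0,c)\in\mathbb{C}^n$. Then $\Lambda$ is a complete set of invariants of all pure geometric progression states on $\mathcal{O}_n$: every pure geometric progression state on $\mathcal{O}_n$ (of any finite order $k\ge1$ or of order $\infty$) is of the form $\omega^{v}$ for some $v\in\Lambda$, and for any two distinct $v,v'\in\Lambda$ the GNS representations of $\omega^{v}$ and $\omega^{v'}$ are not unitarily equivalent.
   Context: For $2\le n<\infty$, $\mathcal{O}_n$ denotes the Cuntz algebra: the universal unital C$^*$-algebra generated by $s_1,\ldots,s_n$ with $s_i^*s_j=\delta_{ij}I$ and $\sum_{i=1}^n s_is_i^*=I$. $(\mathbb{C}^m)_1$ is the set of unit vectors of $\mathbb{C}^m$, and $\ell^2_1$ the set of unit vectors of $\ell^2=\ell^2(\{1,2,\ldots\})$. Convention: $s_n^0=I$. Geometric progression states: - Order $k$ ($1\le k<\infty$, $m=(n-1)k+1$): a state $\omega$ on $\mathcal{O}_n$ is a geometric progression state by $z\in(\mathbb{C}^m)_1$ if $\omega(s_n^rs_i)=\overline{z_{(n-1)r+i}}$ for all $r=0,\ldots,k-1$ and $i=1,\ldots,n-1$, and $\omega(s_n^k)=\overline{z_m}$. -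 Order $\infty$: a state $\omega$ on $\mathcal{O}_n$ is a geometric progression state by $z\in\ell^2_1$ if $\omega(s_n^rs_i)=\overline{z_{(n-1)r+i}}$ for all $r\ge 0$ and $i=1,\ldots,n-1$. For each $z\in\ell^2_1$ there is exactly one such state, and it is pure; it is denoted $\omega'_z$. Cuntz state: for $y\in(\mathbb{C}^n)_1$, the Cuntz state by $y$ is the unique (and pure) state $\omega_y$ on $\mathcal{O}_n$ with $\omega_y(s_j)=\overline{y_j}$ for $j=1,\ldots,n$ (equivalently, the geometric progression state of order $1$ by $y$). *)

(* Defs.v *)
From HB Require Import structures.
From mathcomp Require Export all_boot all_order all_algebra.
From mathcomp Require Export all_classical all_reals all_analysis.
From mathcomp Require Export complex.

Set Implicit Arguments.
Unset Strict Implicit.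
Unset Printing Implicit Defensive.

Export Order.TTheory GRing.Theory Num.Theory.
Export numFieldNormedType.Exports.

Local Open Scope classical_set_scope.
Local Open Scope ring_scope.

Notation normc := Normc.normc.

(* The library has no common substructure of its normed modules and its rings
   other than the numeric domains, so the norm of a C*-algebra is a separate,
   real-valued operation and completeness is stated for Cauchy sequences. The
   algebra is unital and nonzero, as every [GRing.Algebra] is. *)
HB.mixin Record isCStarAlgebra (R : realType) A of GRing.Algebra R[i] A := {
  star : A -> A;
  cnorm : A -> R;
  cnormD_le : forall x y : A, cnorm (x + y) <= cnorm x + cnorm y;
  cnormZ : forall (c : R[i]) (x : A), cnorm (c *: x) = normc c * cnorm x;
  cnorm_eq0 : forall x : A, cnorm x = 0 -> x = 0;
  cnormM_le : forall x y : A, cnorm (x * y) <= cnorm x * cnorm y;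
  starD : forall x y : A, star (x + y) = star x + star y;
  starZ : forall (c : R[i]) (x : A), star (c *: x) = c^* *: star x;
  starM : forall x y : A, star (x * y) = star y * star x;
  starK : forall x : A, star (star x) = x;
  cnorm_starM : forall x : A, cnorm (star x * x) = cnorm x ^+ 2;
  cnorm_complete : forall u : nat -> A,
    (forall e : R, 0 < e -> exists N : nat, forall i j : nat,
       (N <= i)%N -> (N <= j)%N -> cnorm (u i - u j) < e) ->
    exists l : A, (fun i => cnorm (u i - l)) @ \oo --> (0 : R)
}.

#[short(type="cstarAlgType")]
HB.structure Definition CStarAlgebra (R : realType) :=
  {A of isCStarAlgebra R A & GRing.Algebra R[i] A}.

(* The norm of a normed module over R[i] is valued in R[i]. The inner product is linear in its first argument. *)
HB.mixin Record isHilbert (R : realType) H of CompleteNormedModule R[i] H := {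
  dot : H -> H -> R[i];
  dotDl : forall x y z : H, dot (x + y) z = dot x z + dot y z;
  dotZl : forall (c : R[i]) (x y : H), dot (c *: x) y = c * dot x y;
  dotC : forall x y : H, dot y x = (dot x y)^*;
  dotE : forall x : H, dot x x = `|x| ^+ 2
}.

#[short(type="hilbertType")]
HB.structure Definition Hilbert (R : realType) :=
  {H of isHilbert R H & CompleteNormedModule R[i] H}.

Section Cuntz.
Context (R : realType).
Implicit Types (A B : cstarAlgType R) (H K : hilbertType R) (p : nat).

(* The number of generators is n = p.+1, so p = n - 1, and s_1, ..., s_n are
   [s 0], ..., [s p]; in particular s_n is [s ord_max]. *)
Definition cuntz_family A p (s : 'I_p.+1 -> A) : Prop :=
  (forall i j, star (s i) * s j = (i == j)%:R) /\
  \sum_(i < p.+1) s i * star (s i) = 1.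

Definition cnorm_closed A (S : set A) : Prop :=
  forall (u : nat -> A) (l : A), (forall i, S (u i)) ->
    (fun i => cnorm (u i - l)) @ \oo --> (0 : R) -> S l.

(* The norm-closed unital *-subalgebra generated by G is A. *)
Definition star_generates A (G : set A) : Prop :=
  forall S : set A, G `<=` S -> cnorm_closed S -> S 1 ->
    (forall x y, S x -> S y -> S (x + y)) ->
    (forall (c : R[i]) x, S x -> S (c *: x)) ->
    (forall x y, S x -> S y -> S (x * y)) ->
    (forall x, S x -> S (star x)) ->
    S = setT.

Definition is_cuntz_algebra A p (s : 'I_p.+1 -> A) : Prop :=
  [/\ cuntz_family s,
      star_generates (range s)
    & forall B (t : 'I_p.+1 -> B), cuntz_family t ->
        exists f : {lrmorphism A -> B},
          {morph f : x / star x} /\ forall i, f (s i) = t i].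

(* Positive linear functionals of norm 1. In R[i], [0 <= x] means that x is real
   and nonnegative. *)
Definition is_state A (w : A -> R[i]) : Prop :=
  [/\ scalar w,
      forall a, 0 <= w (star a * a),
      forall a, normc (w a) <= cnorm a
    & w 1 = 1].

Definition is_pure_state A (w : A -> R[i]) : Prop :=
  is_state w /\
  forall (f g : A -> R[i]) (t : R[i]), is_state f -> is_state g -> 0 < t < 1 ->
    (forall a, w a = t * f a + (1 - t) * g a) -> f = w /\ g = w.

Definition is_representation A H (pi : A -> H -> H) : Prop :=
  [/\ forall a, linear (pi a) /\ continuous (pi a),
      forall (c : R[i]) a b x, pi (c *: a + b) x = c *: pi a x + pi b x,
      forall a b x, pi (a * b) x = pi a (pi b x),
      forall x, pi 1 x = x
    & forall a x y, dot (pi (star a) x) y = dot x (pi a y)].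

(* The GNS representation is determined by these properties up to unitary
   equivalence. *)
Definition is_GNS A (w : A -> R[i]) H (pi : A -> H -> H) (Omega : H) : Prop :=
  [/\ is_state w, is_representation pi,
      forall a, w a = dot (pi a Omega) Omega
    & dense (range (fun a => pi a Omega))].

Definition unitarily_equivalent A H K (pi : A -> H -> H) (rho : A -> K -> K) :
    Prop :=
  exists U : {linear H -> K},
    [/\ bijective U,
        forall x y, dot (U x) (U y) = dot x y
      & forall a x, U (pi a x) = rho a (U x)].

Definition unit_vector m : set 'rV[R[i]]_m :=
  [set z | \sum_(j < m) normc (z 0 j) ^+ 2 = 1].

(* [z j] is z_(j+1). *)
Definition unit_l2 : set (nat -> R[i]) :=
  [set z | series (fun j => normc (z j) ^+ 2) @ \oo --> (1 : R)].

Section States.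
Context (A : cstarAlgType R) (p : nat) (s : 'I_p.+1 -> A).

(* s_n ^ r s_(i+1), with 0 <= i < n - 1. *)
Definition gp_word (r : nat) (i : 'I_p) : A :=
  s ord_max ^+ r * s (widen_ord (leqnSn p) i).

(* The entry z_m, m = (n - 1) k + 1, is [z 0 ord_max]. *)
Definition is_gp_state (k : nat) (z : 'rV[R[i]]_(p * k).+1) (w : A -> R[i]) :
    Prop :=
  [/\ is_state w,
      forall (r : 'I_k) (i : 'I_p), w (gp_word r i) = (z 0 (inord (p * r + i)%N))^*
    & w (s ord_max ^+ k) = (z 0 ord_max)^*].

Definition is_gp_state_infty (z : nat -> R[i]) (w : A -> R[i]) : Prop :=
  is_state w /\
  forall (r : nat) (i : 'I_p), w (gp_word r i) = (z (p * r + i)%N)^*.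

Definition is_geometric_progression_state (w : A -> R[i]) : Prop :=
  (exists (k : nat) (z : 'rV[R[i]]_(p * k).+1),
     [/\ (1 <= k)%N, unit_vector z & is_gp_state z w]) \/
  (exists2 z : nat -> R[i], unit_l2 z & is_gp_state_infty z w).

Definition is_cuntz_state (y : 'rV[R[i]]_p.+1) (w : A -> R[i]) : Prop :=
  is_state w /\ forall j, w (s j) = (y 0 j)^*.

(* "The" state with parameter v; the default value, which is not a state, is
   irrelevant for v in [Lambda]. *)
Definition omega (v : (nat -> R[i]) + 'rV[R[i]]_p.+1) : A -> R[i] :=
  xget (fun=> 0) [set w | match v with
                          | inl z => is_gp_state_infty z w
                          | inr y => is_cuntz_state y w
                          end].

End States.

Definition Lambda p : set ((nat -> R[i]) + 'rV[R[i]]_p.+1) :=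
  [set v | match v with
           | inl z => unit_l2 z
           | inr y => exists c : R[i],
               normc c = 1 /\ y = \row_j (if j == ord_max then c else 0)
           end].

End Cuntz.

(* Main.v *)
(* Write u = s_n, E = E_(r,i) = s_n^r s_i with i < n, and x Omega for the vector of x
   in the GNS space of a state. If w(E) = conj z_E for all E and z is a unit vector,
   Bessel's inequality for the orthonormal vectors E Omega is an equality, so
   E^* Omega = z_E Omega and |u^*^M Omega| -> 0; these relations determine w. In
   order k they give u^*^k Omega = z_m Omega. When |z_m| < 1, iterating turns w into a
   state of order infinity. When |z_m| = 1, Omega is a sum of eigenvectors of u, w is
   the corresponding convex combination of Cuntz states, and purity leaves only
   one of them.
   For inequivalence, let X and Y induce two different states in one representation.
   The functional a |-> <a X, Y> multiplies by z_E under E^* on the right and by conj z'_E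
   under E on the left, so it is determined by its value at 1; moreover
   <X, Y> = (sum z_E conj z'_E) <X, Y> up to a vanishing tail, so <X, Y> = 0. Then Y
   is orthogonal to the cyclic subspace of X. *)

Require Import Defs.
From mathcomp Require Import all_boot all_order all_algebra.
From mathcomp Require Import all_classical all_reals all_analysis complex.
From mathcomp Require Import ring lra.

Set Implicit Arguments.
Unset Strict Implicit.
Unset Printing Implicit Defensive.

Local Open Scope classical_set_scope.
Local Open Scope ring_scope.

Local Notation toC := (real_complex _).

(** * Complex numbers and positive forms *)

Section ComplexNumbers.
Context {R : realType}.
Implicit Types (z : R[i]) (a : R).

Lemma mulc_conj z : z * z^* = toC (normc z ^+ 2).
Proof. by rewrite -normCK normc_def; case: z => a b /=; rewrite rmorphXn. Qed.

Lemma normc_ge0 z : 0 <= normc z.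
Proof. by case: z => a b; exact: sqrtr_ge0. Qed.

Lemma normc_conj z : normc z^* = normc z.
Proof. by case: z => a b /=; rewrite sqrrN. Qed.

Lemma normcX z n : normc (z ^+ n) = normc z ^+ n.
Proof.
elim: n => [|n IHn]; first exact: Normc.normc1.
by rewrite !exprS Normc.normcM IHn.
Qed.

Lemma normc_real a : 0 <= a -> normc (toC a) = a.
Proof. by move=> a0; rewrite /= expr0n /= addr0 sqrtr_sqr ger0_norm. Qed.

Lemma conj_real a : (toC a)^* = toC a.
Proof. exact: conjc_real. Qed.

Lemma ge0_ReE z : 0 <= z -> z = toC (Re z).
Proof. by case: z => a b; rewrite lecE /= => /andP[/eqP->]. Qed.

Lemma ge0_Re_ge0 z : 0 <= z -> 0 <= Re z.
Proof. by rewrite lecE => /andP[]. Qed.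

Lemma real_complex_ge0 a : (0 <= toC a) = (0 <= a).
Proof. exact: (@lecR R 0 a). Qed.

Lemma ReD z z' : Re (z + z') = Re z + Re z'.
Proof. by case: z; case: z'. Qed.

Lemma Re_sum I (r : seq I) (P : pred I) (F : I -> R[i]) :
  Re (\sum_(i <- r | P i) F i) = \sum_(i <- r | P i) Re (F i).
Proof. exact: (big_morph (@Re R) ReD). Qed.

Lemma Re_le_normc z : Re z <= normc z.
Proof.
case: z => a b /=; apply: le_trans (ler_norm _) _.
by rewrite -sqrtr_sqr ler_wsqrtr // lerDl sqr_ge0.
Qed.

Lemma le_normcB z z' : normc (z - z') <= normc z + normc z'.
Proof. by rewrite -(normcN z'); exact: le_normcD. Qed.

Lemma sqr_normcB z z' :
  normc (z - z') ^+ 2 = normc z ^+ 2 + normc z' ^+ 2 - 2 * Re (z'^* * z).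
Proof.
have sq (y : R[i]) : normc y ^+ 2 = Re y ^+ 2 + Im y ^+ 2.
  by case: y => a b; rewrite /= sqr_sqrtr // addr_ge0 ?sqr_ge0.
by rewrite !sq; case: z => a b; case: z' => c d /=; ring.
Qed.

Lemma normc_small_eq0 z : (forall e : R, 0 < e -> normc z <= e) -> z = 0.
Proof.
move=> zs; apply: Normc.eq0_normc; apply/eqP; rewrite eq_le normc_ge0 andbT.
by apply/ler_addgt0Pl => e e0; rewrite addr0; exact: zs.
Qed.

End ComplexNumbers.

(** * Complex-linear functionals *)

Section Functionals.
Context {R : realType} {L : lmodType R[i]} (f : L -> R[i]).
Hypothesis f_scalar : scalar f.

Lemma functionalD x y : f (x + y) = f x + f y.
Proof. by have := f_scalar 1 x y; rewrite scale1r mul1r. Qed.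

Lemma functional0 : f 0 = 0.
Proof. by apply: (addrI (f 0)); rewrite -functionalD !addr0. Qed.

Lemma functionalZ c x : f (c *: x) = c * f x.
Proof. by have := f_scalar c x 0; rewrite addr0 functional0 addr0. Qed.

Lemma functionalN x : f (- x) = - f x.
Proof. by rewrite -scaleN1r functionalZ mulN1r. Qed.

Lemma functionalB x y : f (x - y) = f x - f y.
Proof. by rewrite functionalD functionalN. Qed.

Lemma functional_sum I (r : seq I) (P : pred I) (F : I -> L) :
  f (\sum_(i <- r | P i) F i) = \sum_(i <- r | P i) f (F i).
Proof. exact: (big_morph f functionalD functional0). Qed.

End Functionals.

(** The expression is the squared length of x - t B(x,y) y for a semidefinite form B, with n =
    |B(x,y)|^2. It is smallest at t = 1/b; for b = 0 a large t gives a contradiction unless n =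
    0. *)
Lemma quadratic_ge0_bound {R : realType} (a b n : R) :
  0 <= a -> 0 <= b -> 0 <= n ->
  (forall t : R, 0 <= a - 2 * t * n + t ^+ 2 * n * b) -> n <= a * b.
Proof.
move=> a0 b0 n0 h; case: (eqVneq b 0) => [bE|bn].
  case: (eqVneq n 0) => [->|nn]; first by rewrite mulr_ge0.
  (* For b = 0 this t turns the expression into -a - 2 < 0. *)
  have := h ((a + 1) / n).
  rewrite bE mulr0 addr0 -mulrA divfK //; lra.
have bp : 0 < b by rewrite lt_def bn.
have := h b^-1.
have -> : a - 2 * b^-1 * n + b^-1 ^+ 2 * n * b = (a * b - n) / b by field.
by rewrite pmulr_lge0 ?invr_gt0 // subr_ge0.
Qed.

(** Stated for semidefinite forms, so that it covers [dot] and also the forms [w (star y * x)] of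
    positive functionals. *)
Lemma cauchy_schwarz {R : realType} {L : lmodType R[i]}
    (B : L -> L -> R[i]) :
  (forall y, scalar (B^~ y)) -> (forall x y, B y x = (B x y)^*) ->
  (forall x, 0 <= B x x) ->
  forall x y, normc (B x y) ^+ 2 <= Re (B x x) * Re (B y y).
Proof.
move=> Bl BC B0 x y.
apply: quadratic_ge0_bound; rewrite ?ge0_Re_ge0 ?sqr_ge0 // => t.
have Br a u v w : B w (a *: u + v) = a^* * B w u + B w v.
  by rewrite (BC _ w) (Bl w a u v) rmorphD rmorphM (BC u w) (BC v w).
have := B0 (- (toC t * B x y) *: y + x).
rewrite (Bl _ (- (toC t * B x y)) y x) !Br.
have -> : (- (toC t * B x y))^* = - (toC t * (B x y)^*).
  by rewrite rmorphN rmorphM /= conj_real.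
set z := B x y; rewrite (BC x y) -/z.
move: (Re (B x x)) (Re (B y y)) (ge0_ReE (B0 x)) (ge0_ReE (B0 y)) => a b -> ->.
have -> : - (toC t * z) * (- (toC t * z^*) * toC b + z^*)
    + (- (toC t * z^*) * z + toC a) =
    toC a - 2 * toC t * (z * z^*) + toC t ^+ 2 * (z * z^*) * toC b by ring.
have -> : (2 : R[i]) = toC 2 by rewrite rmorph_nat.
by rewrite mulc_conj -!rmorphXn -!rmorphM -rmorphB -rmorphD real_complex_ge0.
Qed.

(** * C*-algebras and states *)

Lemma cvg0_le {R : realType} (u v : nat -> R) :
  (forall i, 0 <= u i <= v i) -> v @ \oo --> (0 : R) -> u @ \oo --> (0 : R).
Proof.
move=> uv v0; apply: (@squeeze_cvgr _ _ _ _ (fun=> 0) v) => //.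
  by near=> i; exact: uv.
exact: cvg_cst.
Unshelve. all: by end_near. Qed.

Lemma bernoulli_le {R : realType} (d : R) n : 0 <= d -> 1 + n%:R * d <= (1 + d) ^+ n.
Proof.
move=> d0; elim: n => [|n IHn]; first by rewrite mul0r addr0 expr0.
rewrite exprS -natr1; apply: le_trans (ler_wpM2l _ IHn); last by rewrite addr_ge0.
have : 0 <= n%:R * d * d by rewrite !mulr_ge0.
by rewrite mulrDr !mulrDl !mul1r; lra.
Qed.

(** If y < x, the powers of x / y = 1 + d grow without bound by Bernoulli's inequality and exceed
    C. *)
Lemma le_of_dyadic_powers {R : realType} (x y C : R) :
  0 <= x -> 0 <= y -> (forall m, x ^+ (2 ^ m) <= C * y ^+ (2 ^ m)) -> x <= y.
Proof.
move=> x0 y0 h; rewrite leNgt; apply/negP => yx.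
have xp : 0 < x by apply: le_lt_trans yx.
have C0 : 0 < C.
  have := lt_le_trans (exprn_gt0 1 xp) (h 0%N); rewrite !expr1 => Cy.
  by rewrite ltNge; apply/negP => C0; have := mulr_le0_ge0 C0 y0; rewrite leNgt Cy.
case: (eqVneq y 0) => [yE|yn].
  by have := h 0%N; rewrite yE expr1 mulr0 leNgt xp.
have yp : 0 < y by rewrite lt_def yn.
set d := x / y - 1.
have d0 : 0 < d by rewrite subr_gt0 ltr_pdivlMr // mul1r.
have [n nC] : exists n : nat, C / d < n%:R.
  by exists (Num.bound (C / d)); apply: archi_boundP; rewrite divr_ge0 // ltW.
have := h n; rewrite -ler_pdivrMr ?exprn_gt0 // -expr_div_n leNgt => /negP; apply.
have -> : x / y = 1 + d by rewrite /d addrC subrK.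
apply: lt_le_trans (bernoulli_le _ (ltW d0)).
have : C < (2 ^ n)%N%:R * d.
  rewrite -ltr_pdivrMr //; apply: lt_trans nC _; rewrite ltr_nat.
  exact: ltn_expl.
lra.
Qed.

Section CStarAlgebras.
Context {R : realType} {A : cstarAlgType R}.
Implicit Types (x y a b : A).

Lemma star1 : star (1 : A) = 1.
Proof.
have := starM (star 1) (1 : A).
by rewrite mulr1 starK mulr1 => /esym.
Qed.

Lemma star0 : star (0 : A) = 0.
Proof. by apply: (addrI (star 0)); rewrite -starD !addr0. Qed.

Lemma starN x : star (- x) = - star x.
Proof. by apply: (addrI (star x)); rewrite -starD !subrr star0. Qed.

Lemma starB x y : star (x - y) = star x - star y.
Proof. by rewrite starD starN. Qed.

Lemma star_sum I (r : seq I) (P : pred I) (F : I -> A) :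
  star (\sum_(i <- r | P i) F i) = \sum_(i <- r | P i) star (F i).
Proof. exact: (big_morph star (@starD _ _) star0). Qed.

Lemma starX x n : star (x ^+ n) = star x ^+ n.
Proof.
by elim: n => [|n IHn]; rewrite ?star1 // exprS starM IHn -exprSr.
Qed.

Lemma cnorm0 : cnorm (0 : A) = 0.
Proof. by have := cnormZ 0 (0 : A); rewrite scale0r Normc.normc0 mul0r. Qed.

Lemma cnormN x : cnorm (- x) = cnorm x.
Proof. by rewrite -scaleN1r cnormZ normcN Normc.normc1 mul1r. Qed.

Lemma cnorm_ge0 x : 0 <= cnorm x.
Proof.
have := cnormD_le x (- x); rewrite subrr cnorm0 cnormN; lra.
Qed.

(** The C*-identity and submultiplicativity give |y|^2 <= |y*| |y|; applying this to y and y* gives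
    both inequalities. *)
Lemma cnorm_star x : cnorm (star x) = cnorm x.
Proof.
have le y : cnorm y <= cnorm (star y).
  case: (eqVneq (cnorm y) 0) => [->|yn]; first exact: cnorm_ge0.
  have yp : 0 < cnorm y by rewrite lt_def yn cnorm_ge0.
  by rewrite -(ler_pM2r yp) -expr2 -cnorm_starM cnormM_le.
by apply/eqP; rewrite eq_le (le x) -{2}(starK x) le.
Qed.

Lemma cnormX_le x n : (0 < n)%N -> cnorm (x ^+ n) <= cnorm x ^+ n.
Proof.
case: n => // n _; elim: n => [|n IHn]; first by rewrite !expr1.
rewrite exprS [leRHS]exprS; apply: le_trans (cnormM_le _ _) _.
by rewrite ler_wpM2l ?cnorm_ge0.
Qed.

Definition bounded_functional (f : A -> R[i]) : Prop :=
  scalar f /\ exists C : R, forall a, normc (f a) <= C * cnorm a.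

Lemma bounded_functional_ge0 f : bounded_functional f ->
  exists2 C : R, 0 <= C & forall a, normc (f a) <= C * cnorm a.
Proof.
case=> _ [C hC]; exists `|C| => // a; apply: le_trans (hC a) _.
by rewrite ler_wpM2r ?cnorm_ge0 ?ler_norm.
Qed.

Lemma bounded_functionalMl f b :
  bounded_functional f -> bounded_functional (fun a => f (b * a)).
Proof.
move=> hf; have [C C0 hC] := bounded_functional_ge0 hf; case: hf => fl _.
split; first by move=> k x y; rewrite mulrDr -scalerAr fl.
exists (C * cnorm b) => a; apply: le_trans (hC _) _.
by rewrite -mulrA ler_wpM2l ?cnormM_le.
Qed.

Lemma bounded_functionalMr f b :
  bounded_functional f -> bounded_functional (fun a => f (a * b)).
Proof.
move=> hf; have [C C0 hC] := bounded_functional_ge0 hf; case: hf => fl _.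
split; first by move=> k x y; rewrite mulrDl -scalerAl fl.
exists (C * cnorm b) => a; apply: le_trans (hC _) _.
by rewrite -mulrA ler_wpM2l // mulrC cnormM_le.
Qed.

Lemma bounded_functionalB f g : bounded_functional f -> bounded_functional g ->
  bounded_functional (fun a => f a - g a).
Proof.
move=> [fl [C hC]] [gl [D hD]]; split.
  by move=> k x y; rewrite fl gl mulrBr opprD addrACA.
exists (C + D) => a; apply: le_trans (le_normcB _ _) _.
by rewrite mulrDl lerD.
Qed.

Lemma bounded_functional_closed f (u : nat -> A) l :
  bounded_functional f -> (fun i => cnorm (u i - l)) @ \oo --> (0 : R) ->
  (forall i, f (u i) = 0) -> f l = 0.
Proof.
move=> hf ul fu; have [C C0 hC] := bounded_functional_ge0 hf; case: hf => fl _.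
apply: Normc.eq0_normc.
have h0 : (fun i : nat => normc (f l)) @ \oo --> (0 : R).
  apply: (@cvg0_le _ _ (fun i => C * cnorm (u i - l))).
    move=> i; rewrite normc_ge0 /=; apply: le_trans (hC _).
    by rewrite (functionalB fl) fu sub0r normcN.
  by rewrite -[X in _ --> X](mulr0 C); apply: cvgMr.
have h1 : (fun i : nat => normc (f l)) @ \oo --> normc (f l) by exact: cvg_cst.
exact: (cvg_unique _ h1 h0).
Qed.

(** * Positive functionals *)

Section Positive.
Variable w : A -> R[i].
Hypotheses (w_scalar : scalar w) (w_pos : forall a, 0 <= w (star a * a)).

Lemma positive_star a : w (star a) = (w a)^*.
Proof.
have exp (c : R[i]) : star (c *: a + 1) * (c *: a + 1) =
    (conjc c * c) *: (star a * a) + (conjc c *: star a + (c *: a + 1)).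
  rewrite -[conjc c]/(c^* ) starD star1 starZ mulrDl mul1r mulrDr mulr1.
  rewrite -scalerAl -scalerAr.
  by rewrite scalerA -addrA.
have := w_pos (1 *: a + 1); rewrite exp !(functionalD w_scalar) !(functionalZ w_scalar).
have := w_pos ('i%C *: a + 1).
rewrite exp !(functionalD w_scalar) !(functionalZ w_scalar).
have := w_pos 1; rewrite star1 mulr1 => /ge0_ReE ->.
have := w_pos a => /ge0_ReE ->.
rewrite -[_^*]/(conjc _).
case: (w a) (w (star a)) => a1 a2 [b1 b2]; rewrite !lecE /=.
move=> /andP[/eqP h1 _] /andP[/eqP h2 _]; congr Complex; lra.
Qed.

Lemma positive_cauchy_schwarz x y :
  normc (w (star y * x)) ^+ 2 <= Re (w (star x * x)) * Re (w (star y * y)).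
Proof.
apply: (@cauchy_schwarz _ _ (fun x y => w (star y * x))) => //.
- by move=> z k a b /=; rewrite mulrDr -scalerAr w_scalar.
- by move=> a b; rewrite -positive_star starM starK.
Qed.

Lemma positive_null x : w (star x * x) = 0 -> forall a, w (a * x) = 0.
Proof.
move=> wx a; apply: Normc.eq0_normc; apply/eqP; rewrite -sqrf_eq0 eq_le sqr_ge0.
have := positive_cauchy_schwarz x (star a).
by rewrite starK wx mul0r => ->.
Qed.

End Positive.

Lemma state_bounded (w : A -> R[i]) : is_state w -> bounded_functional w.
Proof. by case=> wl _ wb _; split=> //; exists 1 => a; rewrite mul1r. Qed.

(* The bound by the norm needs no square roots in A: iterating the
   Cauchy-Schwarz inequality gives f(h)^(2^m) <= C |h|^(2^m) for h = a* a. *)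
Lemma positive_is_state (f : A -> R[i]) :
  bounded_functional f -> (forall a, 0 <= f (star a * a)) -> f 1 = 1 ->
  is_state f.
Proof.
move=> fb f0 f1; have [C C0 hC] := bounded_functional_ge0 fb; case: fb => fl _.
have cs1 x : normc (f x) ^+ 2 <= Re (f (star x * x)).
  have := positive_cauchy_schwarz fl f0 x 1.
  by rewrite star1 !mul1r f1 /= mulr1.
split=> // a; set h := star a * a.
have hh : star h = h by rewrite starM starK.
(* An even power is a square of a self-adjoint element; in an odd power the middle factor h = a* a
   is split into its two halves. *)
have fh0 n : 0 <= f (h ^+ n).
  have -> : h ^+ n = star (h ^+ n./2) * (h ^+ odd n * h ^+ n./2).
    by rewrite starX hh -!exprD addnCA addnn odd_double_half.
  case: (odd n); last by rewrite mul1r.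
  by rewrite expr1 {2}/h -mulrA mulrA -starM.
have hm m : Re (f h) ^+ (2 ^ m) <= Re (f (h ^+ (2 ^ m))).
  elim: m => [|m IHm]; first by rewrite !expr1.
  rewrite expnS mulnC !exprM.
  apply: (@le_trans _ _ (Re (f (h ^+ (2 ^ m))) ^+ 2)).
    by rewrite lerXn2r ?nnegrE ?exprn_ge0 ?ge0_Re_ge0 //; have := fh0 1%N.
  have := cs1 (h ^+ (2 ^ m)); rewrite {1}(ge0_ReE (fh0 _)) normc_real ?ge0_Re_ge0 //.
  by rewrite starX hh -expr2.
have fhle : Re (f h) <= cnorm h.
  apply: (@le_of_dyadic_powers _ _ _ C); rewrite ?cnorm_ge0 ?(ge0_Re_ge0 (f0 a)) // => m.
  apply: le_trans (hm m) _; apply: le_trans (Re_le_normc _) _.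
  by apply: le_trans (hC _) _; rewrite ler_wpM2l // cnormX_le // expn_gt0.
rewrite -(@ler_pXn2r _ 2) ?nnegrE ?normc_ge0 ?cnorm_ge0 //.
by apply: le_trans (cs1 a) _; rewrite -cnorm_starM.
Qed.

(** This is the vector state of b Omega after normalisation; [positive_is_state] supplies the norm
    bound. *)
Lemma vector_is_state (w : A -> R[i]) b : is_state w -> w (star b * b) != 0 ->
  is_state (fun a => w (star b * a * b) / w (star b * b)).
Proof.
move=> ws bn; have [wl w0 _ w1] := ws.
have [tl [C hC]] : bounded_functional (fun a => w (star b * a * b)).
  exact: (bounded_functionalMl (star b) (bounded_functionalMr b (state_bounded ws))).
apply: positive_is_state.
- split; first by move=> k x y; rewrite tl mulrDl mulrA.
  exists (C * normc (w (star b * b))^-1) => a.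
  by rewrite Normc.normcM mulrAC ler_wpM2r ?normc_ge0.
- move=> a; rewrite mulr_ge0 ?invr_ge0 // !mulrA -starM -mulrA; exact: w0.
- by rewrite mulr1 divff.
Qed.

End CStarAlgebras.

(** * Bounded functionals on the Cuntz algebra *)

Section FunctionalsOnCuntz.
Context {R : realType} {A : cstarAlgType R} {p : nat} (s : 'I_p.+1 -> A).
Hypothesis s_cuntz : cuntz_family s.
Implicit Types (x y : A) (w phi : A -> R[i]).

Local Notation u := (s ord_max).
Local Notation e i := (s (widen_ord (leqnSn p) i)).
Local Notation E := (gp_word s).

Lemma widen_neq_max (i : 'I_p) : (widen_ord (leqnSn p) i == ord_max) = false.
Proof. by apply/negbTE; rewrite -val_eqE /= neq_ltn ltn_ord. Qed.

Lemma max_or_widen (j : 'I_p.+1) :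
  j = ord_max \/ exists i, j = widen_ord (leqnSn p) i.
Proof.
case: (unliftP ord_max j) => [i ->|->]; last by left.
by right; exists i; apply: val_inj; rewrite /= /bump leqNgt ltn_ord.
Qed.

Lemma star_maxK : star u * u = 1.
Proof. by case: s_cuntz => -> _; rewrite eqxx. Qed.

Lemma star_maxXK n : star u ^+ n * u ^+ n = 1.
Proof.
elim: n => [|n IHn]; first by rewrite mulr1.
by rewrite exprSr exprS -mulrA [_ * (u * _)]mulrA star_maxK mul1r.
Qed.

Lemma star_widen_max i : star (e i) * u = 0.
Proof. by case: s_cuntz => -> _; rewrite widen_neq_max. Qed.

Lemma star_gp_word r i : star (E r i) = star (e i) * star u ^+ r.
Proof. by rewrite starM starX. Qed.

(** The relation 1 = sum of the s_j s_j^* is inserted between the two powers, and its last term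
    lengthens both. *)
Lemma max_expr_split a b :
  u ^+ b * star u ^+ a =
  \sum_(i < p) E b i * star (E a i) + u ^+ b.+1 * star u ^+ a.+1.
Proof.
have [_ h] := s_cuntz; rewrite big_ord_recr /= in h.
rewrite -{1}[u ^+ b]mulr1 -h mulrDr mulrDl mulr_sumr mulr_suml; congr (_ + _).
  by apply: eq_bigr => i _; rewrite star_gp_word /gp_word !mulrA.
by rewrite exprSr exprS !mulrA.
Qed.

(** * Density of the span of the x y^*, with x and y words *)

Section Words.
Hypothesis s_gen : star_generates (range s).

(** An induction principle in which products grow one letter at a time from the left. *)
Lemma cuntz_ind (T : set A) :
  cnorm_closed T -> T 1 -> (forall x y, T x -> T y -> T (x + y)) ->
  (forall (c : R[i]) x, T x -> T (c *: x)) ->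
  (forall i x, T x -> T (s i * x)) -> (forall i x, T x -> T (star (s i) * x)) ->
  forall x, T x.
Proof.
move=> Tcl T1 TD TZ Ts Tt.
(* Asking that both a and a* preserve T under left multiplication makes S a closed *-subalgebra. *)
pose S := [set a | forall t, T t -> T (a * t) /\ T (star a * t)].
suff ST : S = setT.
  move=> x; have : S x by rewrite ST.
  by move=> /(_ 1 T1) []; rewrite mulr1.
apply: s_gen.
- by move=> _ [i _ <-] t Tt'; split; [exact: Ts|exact: Tt].
- move=> v l vS vl t Tt'.
  have vt (v' : nat -> A) l' : (fun i => cnorm (v' i - l')) @ \oo --> (0 : R) ->
      (fun i => cnorm (v' i * t - l' * t)) @ \oo --> (0 : R).
    move=> v'l; apply: (@cvg0_le _ _ (fun i => cnorm (v' i - l') * cnorm t)).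
      by move=> i; rewrite cnorm_ge0 -mulrBl cnormM_le.
    by rewrite -[X in _ --> X](mul0r (cnorm t)); apply: cvgMl.
  split.
    by apply: (Tcl (fun i => v i * t)); [move=> i; have [] := vS i t Tt'|exact: vt].
  apply: (Tcl (fun i => star (v i) * t)).
    by move=> i; have [] := vS i t Tt'.
  by apply: (vt (star \o v)); under eq_fun do rewrite /= -starB cnorm_star.
- by move=> t Tt'; rewrite star1 !mul1r.
- move=> x y Sx Sy t Tt'; have [a1 a2] := Sx t Tt'; have [b1 b2] := Sy t Tt'.
  by rewrite starD !mulrDl; split; exact: TD.
- move=> c x Sx t Tt'; have [a1 a2] := Sx t Tt'.
  by rewrite starZ -!scalerAl; split; exact: TZ.
- move=> x y Sx Sy t Tt'; rewrite starM -!mulrA.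
  have [b1 _] := Sy t Tt'; have [_ a2] := Sx t Tt'.
  by have [] := Sx _ b1; have [] := Sy _ a2.
- by move=> x Sx t Tt'; rewrite starK and_comm; exact: Sx.
Qed.

(* The words in the generators, cut at each letter other than s_n. *)
Inductive word : A -> Prop :=
| word_max n : word (u ^+ n)
| word_gp r i x : word x -> word (E r i * x).

Lemma word_mull j x : word x -> word (s j * x).
Proof.
case: (max_or_widen j) => [->|[i ->]] wx; last first.
  by have := word_gp 0 i wx; rewrite /gp_word expr0 mul1r.
case: wx => [n|r i y wy]; first by rewrite -exprS; exact: word_max.
by rewrite mulrA /gp_word mulrA -exprS; exact: word_gp.
Qed.

Lemma word_mulr j x : word x -> word (x * s j).
Proof.
elim=> [n|r i y _ IH]; last by rewrite -mulrA; exact: word_gp.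
case: (max_or_widen j) => [->|[i ->]]; first by rewrite -exprSr; exact: word_max.
by have := word_gp n i (word_max 0); rewrite mulr1.
Qed.

Lemma functional_words_eq0 phi : bounded_functional phi ->
  (forall x y, word x -> word y -> phi (x * star y) = 0) ->
  forall a, phi a = 0.
Proof.
move=> phib phi0 a; move: phi phib phi0.
(* The quantifier over [phi] is inside T, so that a letter on the left of the argument can be
   absorbed into the functional. *)
pose T := [set a | forall phi, bounded_functional phi ->
  (forall x y, word x -> word y -> phi (x * star y) = 0) -> phi a = 0].
rewrite -[forall phi, _]/(T a); apply: cuntz_ind => {a}.
- move=> v l vT vl phi phib phi0; apply: (bounded_functional_closed phib vl).
  by move=> i; exact: vT.
- move=> phi phib phi0; have := phi0 1 1 (word_max 0) (word_max 0).
  by rewrite star1 mulr1.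
- move=> x y Tx Ty phi phib phi0.
  by rewrite (functionalD phib.1) Tx // Ty // addr0.
- by move=> c x Tx phi phib phi0; rewrite (functionalZ phib.1) Tx // mulr0.
- move=> i x Tx phi phib phi0.
  apply: (Tx (fun a => phi (s i * a))); first exact: bounded_functionalMl.
  by move=> y z wy wz; rewrite mulrA phi0 //; exact: word_mull.
- move=> j x Tx phi phib phi0.
  apply: (Tx (fun a => phi (star (s j) * a))); first exact: bounded_functionalMl.
  move=> y z wy wz; have phi00 := functional0 phib.1.
  (* If the first word is empty, [star (s j)] joins the adjoint of the second word; otherwise it
     cancels the first letter or gives 0. *)
  case: wy => [[|n]|[|r] i y' wy].
  + rewrite expr0 mul1r -starM -[star _]mul1r.
    by rewrite phi0 //; [exact: (word_max 0)|exact: word_mulr].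
  + rewrite exprS !mulrA; case: s_cuntz => -> _.
    case: eqP => _; last by rewrite !mul0r.
    by rewrite mul1r phi0 //; exact: word_max.
  + rewrite /gp_word expr0 mul1r !mulrA; case: s_cuntz => -> _.
    case: eqP => _; last by rewrite !mul0r.
    by rewrite mul1r phi0.
  + rewrite /gp_word exprS !mulrA; case: s_cuntz => -> _.
    case: eqP => _; last by rewrite !mul0r.
    by rewrite mul1r -[_ * _ * y']/(E r i * y') phi0 //; exact: word_gp.
Qed.

(** On x y^* the two relations strip the blocks off x from the left and off y^* from the right,
    until only powers of s_n remain. *)
Lemma block_functional_eq0 phi (z z' : nat -> 'I_p -> R[i]) :
  bounded_functional phi ->
  (forall r i x, phi (x * star (E r i)) = z r i * phi x) ->
  (forall r i x, phi (E r i * x) = z' r i * phi x) ->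
  (forall a b, phi (u ^+ b * star u ^+ a) = 0) ->
  forall a, phi a = 0.
Proof.
move=> phib hz hz' phi0; apply: functional_words_eq0 => // x y wx wy.
elim: wx => [b|r i x' _ IH]; last by rewrite -mulrA hz' IH mulr0.
elim: wy => [a|r i y' _ IH]; first by rewrite starX phi0.
by rewrite starM mulrA hz IH mulr0.
Qed.

End Words.

(** Iterates [max_expr_split]: the block terms become scalars times [phi 1], and the remaining power
    term is split again. *)
Lemma block_telescope phi (z z' : nat -> 'I_p -> R[i]) : scalar phi ->
  (forall r i x, phi (x * star (E r i)) = z r i * phi x) ->
  (forall r i x, phi (E r i * x) = z' r i * phi x) ->
  forall a b M, phi (u ^+ b * star u ^+ a) =
    (\sum_(r < M) \sum_(i < p) z' (b + r)%N i * z (a + r)%N i) * phi 1 +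
    phi (u ^+ (b + M) * star u ^+ (a + M)).
Proof.
move=> phil hz hz' a b; elim=> [|M IH].
  by rewrite big_ord0 mul0r add0r !addn0.
rewrite IH big_ord_recr /= mulrDl -addrA; congr (_ + _).
rewrite max_expr_split (functionalD phil) (functional_sum phil) !addnS mulr_suml.
congr (_ + _); apply: eq_bigr => i _.
by rewrite hz' -[star _]mul1r hz mulrA.
Qed.

(** For phi(a) = <a X, Y> this says that <u*^(a+M) X, u*^(b+M) Y> tends to 0. The offsets match the
    starting point of [block_telescope]. *)
Definition vanishing phi : Prop := forall a b (eps : R), 0 < eps ->
  \forall M \near \oo, normc (phi (u ^+ (b + M) * star u ^+ (a + M))) <= eps.

Lemma vanishingB phi psi :
  vanishing phi -> vanishing psi -> vanishing (fun a => phi a - psi a).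
Proof.
move=> hphi hpsi a b eps eps0; have e20 : 0 < eps / 2 by rewrite divr_gt0.
have -> : eps = eps / 2 + eps / 2 by field.
near=> M; apply: le_trans (le_normcB _ _) _; apply: lerD; near: M.
  exact: hphi.
exact: hpsi.
Unshelve. all: by end_near. Qed.

Lemma vanishing_block_eq0 phi (z z' : nat -> 'I_p -> R[i]) :
  star_generates (range s) -> bounded_functional phi ->
  (forall r i x, phi (x * star (E r i)) = z r i * phi x) ->
  (forall r i x, phi (E r i * x) = z' r i * phi x) ->
  vanishing phi -> phi 1 = 0 -> forall a, phi a = 0.
Proof.
move=> gen phib hz hz' van phi1; apply: (block_functional_eq0 gen phib hz hz').
move=> a b; apply: normc_small_eq0 => eps eps0.
have [M _ /(_ M (leqnn M))] := van a b eps eps0.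
by rewrite (block_telescope phib.1 hz hz' a b M) phi1 mulr0 add0r.
Qed.

(** Let S be the partial sum of the z conj z'. Telescoping identifies (1 - S) phi(1) with the tail.
    Since both sums of squares are at most 1, 2 Re(1 - S) is at least the sum of the |z - z'|^2,
    hence at least [d] > 0 once r0 < M. *)
Lemma vanishing_unit_eq0 phi (z z' : nat -> 'I_p -> R[i]) : scalar phi ->
  (forall r i x, phi (x * star (E r i)) = z r i * phi x) ->
  (forall r i x, phi (E r i * x) = (z' r i)^* * phi x) ->
  vanishing phi ->
  (forall M, \sum_(r < M) \sum_(i < p) normc (z r i) ^+ 2 <= 1) ->
  (forall M, \sum_(r < M) \sum_(i < p) normc (z' r i) ^+ 2 <= 1) ->
  (exists r i, z r i <> z' r i) -> phi 1 = 0.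
Proof.
move=> phil hz hz' van z1 z'1 [r0 [i0 zz']].
set d := normc (z r0 i0 - z' r0 i0) ^+ 2.
have d0 : 0 < d.
  rewrite exprn_gt0 // lt_def normc_ge0 andbT; apply/eqP => /Normc.eq0_normc /eqP.
  by rewrite subr_eq0 => /eqP.
have key M : (r0 < M)%N ->
    d * normc (phi 1) <= 2 * normc (phi (u ^+ M * star u ^+ M)).
  move=> rM; have := block_telescope phil hz hz' 0 0 M.
  rewrite !expr0 mulr1 !add0n; set S := \sum_(r < M) _ => h.
  have -> : phi (u ^+ M * star u ^+ M) = (1 - S) * phi 1.
    by apply/eqP; rewrite mulrBl mul1r eq_sym subr_eq addrC -h.
  rewrite Normc.normcM mulrA ler_wpM2r ?normc_ge0 //.
  apply: (@le_trans _ _ (2 * Re (1 - S))); last by rewrite ler_pM2l // Re_le_normc.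
  have -> : Re (1 - S) = 1 - Re S by case: (S).
  have hS : \sum_(r < M) \sum_(i < p) normc (z r i - z' r i) ^+ 2 =
     \sum_(r < M) \sum_(i < p) normc (z r i) ^+ 2
     + \sum_(r < M) \sum_(i < p) normc (z' r i) ^+ 2 - 2 * Re S.
    have -> : Re S = \sum_(r < M) \sum_(i < p) Re ((z' r i)^* * z r i).
      by rewrite Re_sum; apply: eq_bigr => r _; rewrite Re_sum.
    rewrite mulr_sumr -sumrN -!big_split; apply: eq_bigr => r _ /=.
    rewrite mulr_sumr -sumrN -!big_split; apply: eq_bigr => i _ /=.
    exact: sqr_normcB.
  have dS : d <= \sum_(r < M) \sum_(i < p) normc (z r i - z' r i) ^+ 2.
    rewrite (bigD1 (Ordinal rM)) //= (bigD1 i0) //= -addrA lerDl addr_ge0 //.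
      by apply: sumr_ge0 => ? _; rewrite sqr_ge0.
    by do 2!apply: sumr_ge0 => ? _; rewrite sqr_ge0.
  have := z1 M; have := z'1 M; lra.
have phi1 : normc (phi 1) <= 0.
  apply/ler_addgt0Pl => eps eps0; rewrite addr0.
  have de : 0 < d * eps / 2 by rewrite divr_gt0 // mulr_gt0.
  have [M _ hM] := van 0%N 0%N _ de.
  have := hM (maxn M r0.+1) (leq_maxl _ _); rewrite /= !add0n.
  have := key (maxn M r0.+1) (leq_maxr _ _).
  move: (normc _) (normc _) => n1 n2 h1 h2.
  rewrite -(ler_pM2l d0); lra.
by apply: Normc.eq0_normc; apply/eqP; rewrite eq_le phi1 normc_ge0.
Qed.

End FunctionalsOnCuntz.

(** * Eigenvector relations for states *)

Lemma sum_blocks {V : nmodType} (p M : nat) (F : nat -> V) :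
  \sum_(r < M) \sum_(i < p) F (p * r + i)%N = \sum_(0 <= j < p * M) F j.
Proof.
elim: M => [|M IH]; first by rewrite big_ord0 muln0 big_nil.
rewrite big_ord_recr /= IH mulnS addnC.
rewrite [RHS](big_cat_nat (n := (p * M)%N)) ?leq_addr //=; congr (_ + _).
rewrite -{2}(add0n (p * M)%N) big_addn addKn big_mkord.
by apply: eq_bigr => i _; rewrite addnC.
Qed.

Lemma cvg_series_blocks {R : realType} (p : nat) (f : nat -> R) (l : R) :
  (0 < p)%N -> series f @ \oo --> l ->
  (fun M => \sum_(r < M) \sum_(i < p) f (p * r + i)%N) @ \oo --> l.
Proof.
move=> p0 fl; under eq_fun do rewrite sum_blocks.
apply: (@cvg_comp _ _ _ (fun M => (p * M)%N) (series f) \oo \oo) => //.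
apply/cvgnyPge => N; near=> M.
by apply: (@leq_trans M); [near: M; exact: nbhs_infty_ge|exact: leq_pmull].
Unshelve. all: by end_near. Qed.

Section StatesOnCuntz.
Context {R : realType} {A : cstarAlgType R} {p : nat} (s : 'I_p.+1 -> A).
Hypothesis s_cuntz : cuntz_family s.
Implicit Types (x y : A) (w phi : A -> R[i]).

Local Notation u := (s ord_max).
Local Notation E := (gp_word s).

(* In the GNS representation with cyclic vector Omega: E_(r,i)^* Omega = z_(r,i) Omega. *)
Definition block_eigen w (z : nat -> 'I_p -> R[i]) : Prop :=
  forall r i x, w (x * star (E r i)) = z r i * w x.

(** The squared norm of u*^M Omega, as a real number. *)
Definition tail w (M : nat) : R := Re (w (u ^+ M * star u ^+ M)).

(** * Tails and eigenvector defects of one state *)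

Section State.
Variable w : A -> R[i].
Hypothesis w_state : is_state w.

Lemma state_scalar : scalar w. Proof. by case: w_state. Qed.

Lemma state_ge0 x : 0 <= w (star x * x). Proof. by case: w_state. Qed.

Lemma state1 : w 1 = 1. Proof. by case: w_state. Qed.

Lemma state_starr_ge0 x : 0 <= w (x * star x).
Proof. by have := state_ge0 (star x); rewrite starK. Qed.

Lemma state_star x : w (star x) = (w x)^*.
Proof. exact: (positive_star state_scalar state_ge0). Qed.

Lemma state_null x : w (star x * x) = 0 -> forall a, w (a * x) = 0.
Proof. exact: (positive_null state_scalar state_ge0). Qed.

Lemma tail_ge0 M : 0 <= tail w M.
Proof. by rewrite ge0_Re_ge0 // -starX state_starr_ge0. Qed.

Lemma tail_split M :
  tail w M = \sum_(i < p) Re (w (E M i * star (E M i))) + tail w M.+1.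
Proof.
by rewrite /tail max_expr_split // (functionalD state_scalar)
  (functional_sum state_scalar) ReD Re_sum.
Qed.

(** Parseval's identity: the range projections of u^M and of the E_(r,i) with r < M add up to 1. *)
Lemma blocks_tail M :
  \sum_(r < M) \sum_(i < p) Re (w (E r i * star (E r i))) + tail w M = 1.
Proof.
elim: M => [|M IH]; first by rewrite big_ord0 add0r /tail !expr0 mulr1 state1.
by rewrite big_ord_recr /= -addrA -tail_split.
Qed.

Lemma tail_le M N : (M <= N)%N -> tail w N <= tail w M.
Proof.
elim: N => [|N IH]; first by rewrite leqn0 => /eqP->.
rewrite leq_eqVlt => /orP[/eqP->//|]; rewrite ltnS => /IH; apply: le_trans.
rewrite (tail_split N) lerDr sumr_ge0 // => i _.
by rewrite ge0_Re_ge0 ?state_starr_ge0.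
Qed.

Lemma tail_le1 M : tail w M <= 1.
Proof.
by apply: (le_trans (tail_le (leq0n M))); rewrite /tail !expr0 mulr1 state1.
Qed.

(** This is Pythagoras: the left side is |v* Omega - c Omega|^2, and c Omega is the projection of v*
    Omega onto the line of Omega. *)
Lemma eigen_defect v (c : R[i]) : w v = c^* ->
  w (star (star v - c *: 1) * (star v - c *: 1)) =
  toC (Re (w (v * star v)) - normc c ^+ 2).
Proof.
move=> wv; rewrite starB starK starZ star1 mulrBr !mulrBl -!scalerAl -!scalerAr.
rewrite !mulr1 mul1r !(functionalB state_scalar) !(functionalZ state_scalar).
rewrite state_star wv conjCK state1 rmorphB /= -(ge0_ReE (state_starr_ge0 _)).
by rewrite -mulc_conj; ring.
Qed.

Lemma eigen_defect_ge0 v (c : R[i]) : w v = c^* ->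
  normc c ^+ 2 <= Re (w (v * star v)).
Proof.
move=> wv; have := state_ge0 (star v - c *: 1).
by rewrite eigen_defect // real_complex_ge0 subr_ge0.
Qed.

(** The bound forces the defect to be 0, so v* Omega = c Omega, and [state_null] allows any x on the
    left. *)
Lemma eigen_of_defect v (c : R[i]) : w v = c^* ->
  Re (w (v * star v)) <= normc c ^+ 2 ->
  forall x, w (x * star v) = c * w x.
Proof.
move=> wv wvv x; have h : w (star (star v - c *: 1) * (star v - c *: 1)) = 0.
  rewrite eigen_defect //; have -> : Re (w (v * star v)) = normc c ^+ 2.
    by apply: le_anti; rewrite wvv eigen_defect_ge0.
  by rewrite subrr.
have := state_null h x; rewrite mulrBr -scalerAr mulr1.
rewrite (functionalB state_scalar) (functionalZ state_scalar).
by move=> /eqP; rewrite subr_eq0 => /eqP.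
Qed.

(** Equality case of Cauchy-Schwarz for the unit vectors v Omega and Omega. *)
Lemma isometry_eigen v (c : R[i]) : star v * v = 1 -> w v = c^* ->
  normc c = 1 -> forall x, w (x * v) = c^* * w x.
Proof.
move=> vv wv c1; rewrite -[v]starK; apply: eigen_of_defect.
  by rewrite state_star wv.
by rewrite starK vv state1 normc_conj c1 expr1n.
Qed.

Lemma isometry_eigenV v (c : R[i]) : star v * v = 1 -> w v = c^* ->
  normc c = 1 -> forall x, w (x * star v) = c * w x.
Proof.
move=> vv wv c1 x; have h := isometry_eigen vv wv c1.
have : c * w (x * star v * v) = w (x * star v).
  by rewrite h mulrA mulc_conj c1 expr1n mul1r.
by rewrite -mulrA vv mulr1.
Qed.

Lemma block_eigen_gp_word z r i : block_eigen w z -> w (E r i) = (z r i)^*.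
Proof.
move=> wz; rewrite -[E r i]starK state_star -[star _]mul1r wz state1.
by rewrite mulr1.
Qed.

Lemma block_eigen_mull z : block_eigen w z ->
  forall r i x, w (E r i * x) = (z r i)^* * w x.
Proof.
move=> wz r i x; rewrite -[E r i * x]starK state_star starM wz state_star.
by rewrite rmorphM /= conjCK.
Qed.

Lemma block_eigen_sum z M : block_eigen w z ->
  \sum_(r < M) \sum_(i < p) normc (z r i) ^+ 2 = 1 - tail w M.
Proof.
move=> wz; apply/eqP; rewrite eq_sym subr_eq -(blocks_tail M) addrC eq_sym; apply/eqP.
rewrite [RHS]addrC; congr (_ + _); apply: eq_bigr => r _; apply: eq_bigr => i _.
by rewrite wz (block_eigen_gp_word _ _ wz) mulc_conj.
Qed.

Lemma block_eigen_sum_le1 z M : block_eigen w z ->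
  \sum_(r < M) \sum_(i < p) normc (z r i) ^+ 2 <= 1.
Proof. by move=> wz; rewrite block_eigen_sum // gerBl tail_ge0. Qed.

(* Bessel's inequality for the vectors E_(r,i) Omega is an equality. *)
Lemma block_eigen_of_unit (z : nat -> 'I_p -> R[i]) :
  (forall r i, w (E r i) = (z r i)^*) ->
  (fun M => \sum_(r < M) \sum_(i < p) normc (z r i) ^+ 2) @ \oo --> (1 : R) ->
  block_eigen w z /\ tail w @ \oo --> (0 : R).
Proof.
move=> wz z1.
(* The tail and all the defects are nonnegative, and their sum tends to 0; hence the tail tends to 0
   and each fixed defect is 0. *)
have tailS M : tail w M +
    \sum_(r < M) \sum_(i < p) (Re (w (E r i * star (E r i))) - normc (z r i) ^+ 2)
    = 1 - \sum_(r < M) \sum_(i < p) normc (z r i) ^+ 2.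
  rewrite -(blocks_tail M) [in RHS]addrAC -sumrB addrC; congr (_ + _).
  by apply: eq_bigr => r _; rewrite -sumrB.
have d0 r i : 0 <= Re (w (E r i * star (E r i))) - normc (z r i) ^+ 2.
  by rewrite subr_ge0 eigen_defect_ge0.
have S0 : (fun M => 1 - \sum_(r < M) \sum_(i < p) normc (z r i) ^+ 2) @ \oo
    --> (0 : R).
  by rewrite -[X in _ --> X](subrr 1); apply: cvgB => //; exact: cvg_cst.
split; last first.
  apply: cvg0_le S0 => M; rewrite tail_ge0 -tailS lerDl.
  by do 2!apply: sumr_ge0 => ? _.
move=> r0 i0; apply: eigen_of_defect => //; rewrite -subr_le0.
apply/ler_addgt0Pl => eps eps0; rewrite addr0.
have := cvgr_lt _ S0 _ eps0; case=> N _ /(_ (maxn N r0.+1) (leq_maxl _ _)) /= SN.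
apply: le_trans (ltW SN); rewrite -tailS.
rewrite (bigD1 (Ordinal (leq_maxr N r0.+1))) //= (bigD1 i0) //=.
rewrite addrCA -addrA lerDl !addr_ge0 ?tail_ge0 ?sumr_ge0 // => *.
by rewrite sumr_ge0.
Qed.

(** Here u* Omega = c Omega and Omega = c u Omega, so E^* Omega = c^(r+1) s_i^* u Omega = 0. *)
Lemma max_eigen_block (c : R[i]) : (forall x, w (x * star u) = c * w x) ->
  (forall x, w x = c * w (x * u)) -> block_eigen w (fun _ _ => 0).
Proof.
move=> wu wu' r i x; rewrite star_gp_word mulrA.
have -> y : w (y * star u ^+ r) = c ^+ r * w y.
  elim: r => [|r IH]; first by rewrite mulr1 mul1r.
  by rewrite exprSr mulrA wu IH mulrA -exprS.
by rewrite wu' -mulrA star_widen_max // mulr0 (functional0 state_scalar) !mulr0 mul0r.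
Qed.

End State.

(** The bound dominates |phi(u^(b+M) u*^(a+M))|^2 by a product of two tails; both are at most 1, so
    it suffices that one tends to 0. *)
Lemma vanishing_of_tail w1 w2 phi : is_state w1 -> is_state w2 ->
  (forall x y, normc (phi (star y * x)) ^+ 2 <=
     Re (w1 (star x * x)) * Re (w2 (star y * y))) ->
  tail w1 @ \oo --> (0 : R) \/ tail w2 @ \oo --> (0 : R) ->
  vanishing s phi.
Proof.
move=> w1s w2s phile t0 a b eps eps0.
have le M : normc (phi (u ^+ (b + M) * star u ^+ (a + M))) ^+ 2 <=
    tail w1 (a + M) * tail w2 (b + M).
  have := phile (star u ^+ (a + M)) (star u ^+ (b + M)).
  by rewrite !starX starK.
have shift w c : tail w @ \oo --> (0 : R) ->
    \forall M \near \oo, tail w (c + M)%N <= eps ^+ 2.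
  move=> tw; have : (fun M => tail w (M + c)%N) @ \oo --> (0 : R).
    by rewrite (@cvg_shiftn c _ (tail w)).
  move=> /cvgr_le /(_ (eps ^+ 2)); rewrite exprn_gt0 // => /(_ isT).
  by apply: filterS => M; rewrite addnC.
have fin M : tail w1 (a + M)%N <= eps ^+ 2 \/ tail w2 (b + M)%N <= eps ^+ 2 ->
    normc (phi (u ^+ (b + M) * star u ^+ (a + M))) <= eps.
  move=> h; rewrite -(@ler_pXn2r _ 2) ?nnegrE ?normc_ge0 ?(ltW eps0) //.
  apply: le_trans (le M) _; case: h => h; apply: le_trans h.
    by rewrite ler_piMr ?tail_ge0 ?tail_le1.
  by rewrite ler_piMl ?tail_ge0 ?tail_le1.
by case: t0 => /shift h; [have := h a|have := h b];
  apply: filterS => M hM; apply: fin; [left|right].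
Qed.

Lemma state_vanishing w : is_state w -> tail w @ \oo --> (0 : R) -> vanishing s w.
Proof.
move=> ws w0; apply: (@vanishing_of_tail w w) => //; last by left.
exact: (positive_cauchy_schwarz (state_scalar ws) (state_ge0 ws)).
Qed.

Lemma gp_state_infty_block (z : nat -> R[i]) w : (0 < p)%N -> unit_l2 z ->
  is_gp_state_infty s z w ->
  block_eigen w (fun r i => z (p * r + i)%N) /\ tail w @ \oo --> (0 : R).
Proof.
move=> p0 z1 [ws wz]; apply: block_eigen_of_unit => //.
exact: (cvg_series_blocks p0 z1).
Qed.

(** The difference of the two states satisfies the same block relations, vanishes in the limit and
    is 0 at 1. *)
Lemma gp_state_infty_unique (z : nat -> R[i]) w w' : (0 < p)%N ->
  star_generates (range s) -> unit_l2 z ->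
  is_gp_state_infty s z w -> is_gp_state_infty s z w' -> w = w'.
Proof.
move=> p0 gen z1 wz wz'.
have [wE w0] := gp_state_infty_block p0 z1 wz.
have [wE' w'0] := gp_state_infty_block p0 z1 wz'.
have [ws _] := wz; have [ws' _] := wz'.
apply: funext => a; apply/eqP; rewrite -subr_eq0; apply/eqP; move: a.
apply: (vanishing_block_eq0 s_cuntz gen (phi := fun a => w a - w' a)
  (z := fun r i => z (p * r + i)%N) (z' := fun r i => (z (p * r + i)%N)^*)) => //.
- by apply: bounded_functionalB; exact: state_bounded.
- by move=> r i x; rewrite wE wE' mulrBr.
- by move=> r i x; rewrite (block_eigen_mull ws wE) (block_eigen_mull ws' wE') mulrBr.
- by apply: vanishingB; exact: state_vanishing.
- by rewrite !state1 // subrr.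
Qed.

Lemma max_eigenX w (c d : R[i]) : (forall x, w (x * star u) = c * w x) ->
  (forall x, w (u * x) = d * w x) ->
  forall a b, w (u ^+ b * star u ^+ a) = d ^+ b * c ^+ a * w 1.
Proof.
move=> wc wd a b; have -> x : w (u ^+ b * x) = d ^+ b * w x.
  elim: b => [|b IH]; first by rewrite mul1r mul1r.
  by rewrite !exprS -mulrA wd IH mulrA.
rewrite -mulrA; congr (_ * _); elim: a => [|a IH]; first by rewrite mul1r.
by rewrite exprSr wc IH mulrA -exprS.
Qed.

(** As |w(u)| = 1, Omega is an eigenvector of u and of u*. So the state has block coefficients 0,
    and it can be compared with states of order infinity. *)
Lemma cuntz_state_block (c : R[i]) w : normc c = 1 -> is_state w ->
  w u = c^* ->
  [/\ forall x, w (x * star u) = c * w x, forall x, w (u * x) = c^* * w x &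
      block_eigen w (fun _ _ => 0)].
Proof.
move=> c1 ws wu.
have h1 := isometry_eigenV ws (star_maxK s_cuntz) wu c1.
have h2 := isometry_eigen ws (star_maxK s_cuntz) wu c1.
split => //.
  move=> x; rewrite -[_ * x]starK state_star // starM h1 state_star //.
  by rewrite rmorphM /= conjCK.
apply: (max_eigen_block ws h1) => x.
by rewrite h2 mulrA mulc_conj c1 expr1n mul1r.
Qed.

(** The tail is constantly 1, so no limit argument applies; the values on u^b u*^a are computed
    instead. *)
Lemma cuntz_state_unique (c : R[i]) w w' : star_generates (range s) ->
  normc c = 1 -> is_state w -> is_state w' ->
  w u = c^* -> w' u = c^* -> w = w'.
Proof.
move=> gen c1 ws ws' wu wu'.
have [h1 h2 wE] := cuntz_state_block c1 ws wu.
have [h1' h2' wE'] := cuntz_state_block c1 ws' wu'.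
apply: funext => a; apply/eqP; rewrite -subr_eq0; apply/eqP; move: a.
apply: (block_functional_eq0 s_cuntz gen (phi := fun a => w a - w' a)
  (z := fun _ _ => 0) (z' := fun _ _ => 0)).
- by apply: bounded_functionalB; exact: state_bounded.
- by move=> r i x; rewrite wE wE' mulrBr.
- move=> r i x; rewrite (block_eigen_mull ws wE) (block_eigen_mull ws' wE').
  by rewrite conjC0 mulrBr.
- move=> a b; rewrite (max_eigenX h1 h2) (max_eigenX h1' h2').
  by rewrite !state1 // subrr.
Qed.

End StatesOnCuntz.

(** * States of finite order *)

Lemma double_sum_le0 {R : realType} k p (F : 'I_k -> 'I_p -> R) (t : R) :
  (forall r i, 0 <= F r i) -> 0 <= t -> \sum_(r < k) \sum_(i < p) F r i + t = 0 ->
  (forall r i, F r i <= 0) /\ t <= 0.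
Proof.
move=> F0 t0 tot; split=> [r i|]; rewrite -[leRHS]tot; last first.
  by rewrite lerDr; do 2!apply: sumr_ge0 => ? _.
rewrite (bigD1 r) //= (bigD1 i) //= -!addrA lerDl !addr_ge0 ?sumr_ge0 // => *.
by rewrite sumr_ge0.
Qed.

Section FiniteOrder.
Context {R : realType} {A : cstarAlgType R} {p : nat} (s : 'I_p.+1 -> A).
Hypothesis s_cuntz : cuntz_family s.
Implicit Types (x y : A) (w phi : A -> R[i]).

Local Notation u := (s ord_max).
Local Notation e i := (s (widen_ord (leqnSn p) i)).
Local Notation E := (gp_word s).

Lemma sum_row_blocks k (z : 'rV[R[i]]_(p * k).+1) :
  \sum_(j < (p * k).+1) normc (z 0 j) ^+ 2 =
  \sum_(r < k) \sum_(i < p) normc (z 0 (inord (p * r + i))) ^+ 2 +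
  normc (z 0 ord_max) ^+ 2.
Proof.
rewrite big_ord_recr (sum_blocks p k (fun j => normc (z 0 (inord j)) ^+ 2)) /=.
rewrite big_mkord; congr (_ + _); apply: eq_bigr => j _.
by congr (normc (z 0 _) ^+ 2); apply: val_inj; rewrite /= inordK // ltnS ltnW.
Qed.

(** Each relation has a nonnegative defect, and all the defects together add up to 1 - |z|^2 = 0. *)
Lemma gp_state_block k (z : 'rV[R[i]]_(p * k).+1) w :
  unit_vector z -> is_gp_state s z w ->
  (forall (r : 'I_k) (i : 'I_p) x,
     w (x * star (E r i)) = z 0 (inord (p * r + i)) * w x) /\
  (forall x, w (x * star u ^+ k) = z 0 ord_max * w x).
Proof.
rewrite /unit_vector /= sum_row_blocks => z1 [ws wz wk].
set d := fun (r : 'I_k) (i : 'I_p) =>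
  Re (w (E r i * star (E r i))) - normc (z 0 (inord (p * r + i))) ^+ 2.
have d0 r i : 0 <= d r i by rewrite subr_ge0 eigen_defect_ge0.
have t0 : 0 <= Re (w (u ^+ k * star (u ^+ k))) - normc (z 0 ord_max) ^+ 2.
  by rewrite subr_ge0 eigen_defect_ge0.
have tot : \sum_(r < k) \sum_(i < p) d r i +
    (Re (w (u ^+ k * star (u ^+ k))) - normc (z 0 ord_max) ^+ 2) = 0.
  rewrite addrCA addrA starX [Re _ + _]addrC -/(tail s w k).
  rewrite [X in X + _ - _](_ : _ = 1 - \sum_(r < k) \sum_(i < p)
    normc (z 0 (inord (p * r + i))) ^+ 2 - tail s w k).
    by rewrite subrK -z1 [X in X - _ - _]addrC addrK subrr.
  rewrite -(blocks_tail s_cuntz ws k) addrAC addrK -sumrB.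
  by apply: eq_bigr => r _; rewrite -sumrB.
have [dle tle] := double_sum_le0 d0 t0 tot.
split=> [r i|x].
  by apply: (eigen_of_defect ws (wz r i)); rewrite -subr_le0; exact: dle.
by rewrite -starX; apply: (eigen_of_defect ws wk); rewrite -subr_le0.
Qed.

Lemma gp_state_unit_infty k (z : 'rV[R[i]]_(p * k).+1) w :
  (0 < p)%N -> (0 < k)%N -> unit_vector z -> is_gp_state s z w ->
  normc (z 0 ord_max) < 1 ->
  exists2 z' : nat -> R[i], unit_l2 z' & is_gp_state_infty s z' w.
Proof.
move=> p0 k0 z1 wz zeta1; have [wE wk] := gp_state_block z1 wz.
have [ws _ _] := wz; set zeta := z 0 ord_max in wk zeta1.
have wkq q x : w (x * star u ^+ (k * q)) = zeta ^+ q * w x.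
  elim: q => [|q IH]; first by rewrite muln0 !expr0 mulr1 mul1r.
  by rewrite mulnS addnC exprD mulrA wk IH mulrA -exprS.
(* Entry j is at r = j / p and i = j mod p. If r = k q + r', then E_(r,i)^* = E_(r',i)^* u*^(kq),
   which multiplies Omega by zeta^q z_(r',i). *)
pose z' j := zeta ^+ (j %/ p %/ k) * z 0 (inord (p * ((j %/ p) %% k) + j %% p)).
have wE' : block_eigen s w (fun r i => z' (p * r + i)%N).
  move=> r i x.
  have -> : z' (p * r + i)%N = zeta ^+ (r %/ k) * z 0 (inord (p * (r %% k) + i)).
    rewrite /z' (mulnC p r) divnMDl // modnMDl (divn_small (ltn_ord i)) addn0.
    by rewrite (modn_small (ltn_ord i)).
  rewrite -mulrA -(wE (Ordinal (ltn_pmod r k0))) -wkq.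
  congr (w _); rewrite -mulrA -starX -starM /gp_word mulrA -exprD.
  by rewrite mulnC -divn_eq.
exists z'; last by split=> // r i; exact: (block_eigen_gp_word ws r i wE').
have tailX q : tail s w (k * q) = (normc zeta ^+ 2) ^+ q.
  rewrite /tail wkq -[u ^+ _]starK starX state_star // -[star u ^+ _]mul1r wkq.
  by rewrite state1 // mulr1 mulc_conj normcX exprAC.
have ser M : series (fun j => normc (z' j) ^+ 2) (p * M)%N = 1 - tail s w M.
  by rewrite -(block_eigen_sum s_cuntz ws M wE') /series /= -sum_blocks.
have ser_le : {homo series (fun j => normc (z' j) ^+ 2) : m n / (m <= n)%N >-> m <= n}.
  by apply: nondecreasing_series => j _ _; rewrite sqr_ge0.
set S := series _ in ser ser_le *.
(* The partial sums are known only at multiples of p; monotonicity compares index n with p k (n / (p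
   k)) below and p n above. *)
have bound n : 1 - (normc zeta ^+ 2) ^+ (n %/ (p * k)) <= S n <= 1.
  apply/andP; split; last first.
    apply: (@le_trans _ _ (S (p * n)%N)); first by rewrite ser_le // leq_pmull.
    by rewrite ser gerBl tail_ge0.
  rewrite -tailX; apply: (@le_trans _ _ (S (p * (k * (n %/ (p * k))))%N)).
    by rewrite ser.
  by rewrite ser_le // mulnA mulnC leq_trunc_div.
apply: (@squeeze_cvgr _ _ _ _ (fun n => 1 - (normc zeta ^+ 2) ^+ (n %/ (p * k)))
  (fun=> 1)).
- by near=> n; exact: bound.
- rewrite -[X in _ --> X]subr0; apply: cvgB; first exact: cvg_cst.
  apply: (@cvg_comp _ _ _ (fun n => n %/ (p * k))%N (fun q => (normc zeta ^+ 2) ^+ q)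
    \oo \oo).
    apply/cvgnyPge => N; near=> n; rewrite leq_divRL ?muln_gt0 ?p0 //.
    by near: n; exact: nbhs_infty_ge.
  apply: cvg_expr; rewrite ger0_norm ?sqr_ge0 // expr_lt1 ?normc_ge0 //.
- exact: cvg_cst.
Unshelve. all: by end_near. Qed.

Lemma unit_row_max_le1 k (z : 'rV[R[i]]_(p * k).+1) : unit_vector z ->
  normc (z 0 ord_max) <= 1.
Proof.
rewrite /unit_vector /= sum_row_blocks => z1.
rewrite -(@ler_pXn2r _ 2) ?nnegrE ?normc_ge0 // expr1n -z1 lerDr.
by do 2!apply: sumr_ge0 => ? _; rewrite sqr_ge0.
Qed.

(** * Order k with last coordinate of modulus 1 *)

Section PureState.
Variables (w : A -> R[i]) (k : nat) (zeta : R[i]).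
Hypotheses (w_state : is_state w) (k_gt0 : (0 < k)%N) (zeta1 : normc zeta = 1).
Hypothesis w_maxXV : forall x, w (x * star u ^+ k) = zeta * w x.

Let wD := functionalD (state_scalar w_state).
Let wB := functionalB (state_scalar w_state).
Let wZ := functionalZ (state_scalar w_state).
Let wS := functional_sum (state_scalar w_state).

Lemma state_maxX x : w (x * u ^+ k) = zeta^* * w x.
Proof.
apply: (isometry_eigen w_state) => //; first by rewrite starX star_maxXK.
rewrite -[u ^+ k]starK starX state_star // -[star u ^+ k]mul1r w_maxXV.
by rewrite state1 // mulr1.
Qed.

(* The polynomial X^k - zeta^* annihilates the restriction of s_n to the span of
   the s_n^j Omega, and a factor X - l of it gives an eigenvector b Omega. *)
Lemma max_eigenvector : exists (l : R[i]) b,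
  [/\ l ^+ k = zeta^*, GRing.comm u b, forall x, w (x * u * b) = l * w (x * b)
    & exists x, w (x * b) != 0].
Proof.
(* Factors are peeled off until the remaining product b no longer kills Omega; this happens at the
   latest for the empty product 1. The last factor removed gives the eigenvalue. *)
have roots (rs : seq R[i]) : (forall x, w (x * \prod_(z <- rs) (u - z%:A)) = 0) ->
    exists (l : R[i]) b, [/\ GRing.comm u b, forall x, w (x * u * b) = l * w (x * b)
      & exists x, w (x * b) != 0].
  elim: rs => [|z rs IH] h.
    by have := h 1; rewrite big_nil mulr1 state1 // => /eqP; rewrite oner_eq0.
  set b := \prod_(z <- rs) (u - z%:A) in IH.
  have [/IH//|/existsNP[x /eqP xb]] := pselect (forall x, w (x * b) = 0).
  exists z, b; split; last by exists x.
    apply: commr_prod => y _; apply: commrB => //.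
    by rewrite /GRing.comm -scalerAl -scalerAr mulr1 mul1r.
  move=> y; have := h y; rewrite big_cons -/b mulrBl mulrBr -scalerAl mul1r.
  by rewrite -scalerAr wB wZ mulrA => /eqP; rewrite subr_eq0 => /eqP.
have [rs rsE] := closed_field_poly_normal ('X^k - (zeta^*)%:P : {poly R[i]}).
have [|l [b [ub lb [x xb]]]] := roots rs.
  move=> x; have -> : \prod_(z <- rs) (u - z%:A) = u ^+ k - (zeta^*)%:A.
    transitivity (horner_alg u ('X^k - (zeta^*)%:P)).
      rewrite rsE lead_coefXnsubC // scale1r rmorph_prod; apply: eq_bigr => z _.
      by rewrite rmorphB /= horner_algX horner_algC.
    by rewrite rmorphB rmorphXn /= horner_algX horner_algC.
  by rewrite mulrBr wB state_maxX -scalerAr mulr1 wZ subrr.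
exists l, b; split => //; last by exists x.
(* u^k acts on b Omega by l^k, and also by conj zeta because b commutes with u. *)
apply: (mulIf xb); have <- : w (x * u ^+ k * b) = l ^+ k * w (x * b).
  elim: (k) => [|m IH]; first by rewrite mulr1 mul1r.
  by rewrite exprSr mulrA lb IH mulrA -exprS.
by rewrite -mulrA -(commrX k (commr_sym ub)) mulrA state_maxX.
Qed.

(** Omega is a multiple of u^(kq) Omega for every q, while E_(r,i)^* u^N = 0 as soon as N > r. *)
Lemma state_gp_word_star0 r i x : w (x * star (E r i)) = 0.
Proof.
have wq q : w (x * star (E r i) * u ^+ (k * q)) = (zeta^*) ^+ q * w (x * star (E r i)).
  elim: q => [|q IH]; first by rewrite muln0 !expr0 mulr1 mul1r.
  by rewrite mulnS addnC exprD mulrA state_maxX IH mulrA -exprS.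
have rk : (r < k * r.+1)%N by rewrite -ltnS ltnS leq_pmull.
have : (zeta^*) ^+ r.+1 * w (x * star (E r i)) = 0.
  rewrite -wq -(subnKC rk) exprD exprSr star_gp_word !mulrA.
  rewrite -[_ * star u ^+ r * u ^+ r]mulrA star_maxXK // mulr1.
  rewrite -[x * _ * u]mulrA star_widen_max // mulr0 mul0r.
  exact: (functional0 (state_scalar w_state)).
move=> /eqP; rewrite mulf_eq0 expf_eq0 /= => /orP[/eqP zeta0|/eqP//].
by have := zeta1; rewrite -normc_conj zeta0 Normc.normc0 => /eqP; rewrite eq_sym oner_eq0.
Qed.

(* The average P of the c^j s_n^j projects Omega onto the eigenspace of s_n for
   c^*. *)
Lemma max_eigenprojection : exists (c : R[i]) P,
  [/\ normc c = 1, forall x, w (x * u * P) = c^* * w (x * P),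
      forall x, w (x * star u * P) = c * w (x * P),
      w (star P * P) = w P & w (star P * P) != 0].
Proof.
have [l [b [lk ub lb [x0 xb]]]] := max_eigenvector.
have l1 : normc l = 1.
  have /eqP := congr1 (@normc R) lk; rewrite normcX normc_conj zeta1.
  by rewrite pexpr_eq1 ?normc_ge0 // => /eqP.
pose c := l^*; have c1 : normc c = 1 by rewrite normc_conj.
have cl : c * l = 1 by rewrite mulrC mulc_conj l1 expr1n.
have ck : c ^+ k = zeta by rewrite -rmorphXn /= lk conjCK.
have kn0 : (k%:R : R[i]) != 0 by rewrite pnatr_eq0 -lt0n.
pose P := k%:R^-1 *: \sum_(j < k) c ^+ j *: u ^+ j.
have wP x : w (x * P) = k%:R^-1 * \sum_(j < k) c ^+ j * w (x * u ^+ j).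
  rewrite /P -scalerAr wZ mulr_sumr wS; congr (_ * _); apply: eq_bigr => j _.
  by rewrite -scalerAr wZ.
have uP : GRing.comm u P.
  rewrite /GRing.comm /P -scalerAr -scalerAl mulr_sumr mulr_suml; congr (_ *: _).
  by apply: eq_bigr => j _; rewrite -scalerAr -scalerAl -exprS -exprSr.
(* Multiplication by c u shifts the average cyclically: the wrapped term c^k u^k Omega equals zeta
   conj(zeta) Omega = Omega. *)
have wuP x : c * w (x * u * P) = w (x * P).
  rewrite !wP mulrCA mulr_sumr; congr (_ * _).
  have := big_ord_recr k (fun j => c ^+ j * w (x * u ^+ j)) (op := +%R) (idx := 0).
  rewrite big_ord_recl /= state_maxX ck mulr1 !expr0 mul1r mulrA mulc_conj zeta1.
  rewrite expr1n mul1r [RHS]addrC => /addrI <-; apply: eq_bigr => j _.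
  by rewrite /bump leq0n add1n !exprS !mulrA.
have wuP' x : w (x * u * P) = c^* * w (x * P).
  by rewrite -(wuP x) mulrA [c^* * c]mulrC mulc_conj c1 expr1n mul1r.
have wuP'' x : w (x * star u * P) = c * w (x * P).
  by rewrite -(wuP (x * star u)) -!mulrA [star u * _]mulrA star_maxK // mul1r.
exists c, P; split => //.
  (* Since u*^j P Omega = c^j P Omega, each term of P* fixes P Omega up to the factor 1/k, so P* P
     Omega = P Omega. *)
  have wuj x j : w (x * star u ^+ j * P) = c ^+ j * w (x * P).
    elim: j => [|j IH]; first by rewrite mulr1 mul1r.
    by rewrite exprSr mulrA wuP'' IH mulrA -exprS.
  have -> : star P = k%:R^-1 *: \sum_(j < k) (c ^+ j)^* *: star u ^+ j.
    rewrite /P starZ star_sum fmorphV rmorph_nat; congr (_ *: _).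
    by apply: eq_bigr => j _; rewrite starZ starX.
  rewrite -scalerAl wZ mulr_suml wS.
  under eq_bigr => j _.
    rewrite -scalerAl wZ -[star u ^+ j]mul1r wuj mul1r mulrA [_^* * _]mulrC.
    rewrite mulc_conj normcX c1 expr1n expr1n mul1r; over.
  by rewrite sumr_const card_ord -[w P *+ k]mulr_natl mulrA mulVf ?mul1r.
(* P commutes with b and fixes b Omega because c l = 1; so P Omega = 0 would give b Omega = 0. *)
apply/eqP => P0; have /eqP := state_null w_state P0 (x0 * b).
have bP : b * P = P * b.
  rewrite /P -scalerAr -scalerAl mulr_sumr mulr_suml; congr (_ *: _).
  apply: eq_bigr => j _; rewrite -scalerAr -scalerAl; congr (_ *: _).
  exact: (commrX j (commr_sym ub)).
have lbj x j : w (x * u ^+ j * b) = l ^+ j * w (x * b).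
  elim: j => [|j IH]; first by rewrite mulr1 mul1r.
  by rewrite exprSr mulrA lb IH mulrA -exprS.
rewrite -mulrA bP /P -scalerAl -scalerAr wZ mulr_suml mulr_sumr wS.
under eq_bigr => j _.
  rewrite -scalerAl -scalerAr wZ mulrA lbj mulrA -exprMn cl expr1n mul1r; over.
rewrite sumr_const card_ord -[w _ *+ k]mulr_natl mulrA mulVf // mul1r.
by rewrite (negbTE xb).
Qed.

(** With Q = 1 - P, the vectors P Omega and Q Omega generate orthogonal cyclic subspaces, so w is a
    convex combination of their vector states. Purity identifies w with the state of P Omega, an
    eigenvector of u. *)
Lemma pure_state_max_eigen : star_generates (range s) -> is_pure_state w ->
  exists2 c : R[i], normc c = 1 & w u = c^*.
Proof.
move=> gen [_ pure]; have [c [P [c1 wuP wuP' PP Pn0]]] := max_eigenprojection.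
exists c => //; pose Q := 1 - P.
have w0 := functional0 (state_scalar w_state).
have wuPX n x : w (x * u ^+ n * P) = c^* ^+ n * w (x * P).
  elim: n => [|n IH]; first by rewrite mulr1 mul1r.
  by rewrite exprSr mulrA wuP IH mulrA -exprS.
have wuPX' n x : w (x * star u ^+ n * P) = c ^+ n * w (x * P).
  elim: n => [|n IH]; first by rewrite mulr1 mul1r.
  by rewrite exprSr mulrA wuP' IH mulrA -exprS.
have wEP r i x : w (x * star (E r i) * P) = 0.
  rewrite star_gp_word mulrA wuPX'.
  suff -> : w (x * star (e i) * P) = 0 by rewrite mulr0.
  have := wuP (x * star (e i)); rewrite -[x * _ * u]mulrA star_widen_max //.
  rewrite mulr0 mul0r w0 => /esym/eqP; rewrite mulf_eq0 => /orP[/eqP c0|/eqP//].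
  by have := c1; rewrite -normc_conj c0 Normc.normc0 => /eqP; rewrite eq_sym oner_eq0.
have wEQ r i x : w (x * star (E r i) * Q) = 0.
  by rewrite /Q mulrBr mulr1 wB wEP state_gp_word_star0 subrr.
have QP : w (star Q * P) = 0.
  by rewrite /Q starB star1 mulrBl mul1r wB PP subrr.
(* The functional <a P Omega, Q Omega> has zero block coefficients on both sides, and on u^b u*^a it
   is a multiple of <P Omega, Q Omega> = 0. *)
have cross a : w (star Q * a * P) = 0.
  apply: (block_functional_eq0 s_cuntz gen (phi := fun a => w (star Q * a * P))
    (z := fun _ _ => 0) (z' := fun _ _ => 0)).
  - apply: (bounded_functionalMl (f := fun a => w (a * P))).
    exact: (bounded_functionalMr P (state_bounded w_state)).
  - by move=> r i x; rewrite mulrA wEP mul0r.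
  - move=> r i x; rewrite mul0r -[_ * P]starK state_star // (starM _ P) (starM (star Q)).
    by rewrite starK (starM (E r i)) !mulrA wEQ conjC0.
  - by move=> i j; rewrite mulrA wuPX' wuPX QP !mulr0.
have cross' a : w (star P * a * Q) = 0.
  rewrite -[star P * a * Q]starK state_star // !starM starK mulrA cross.
  exact: conjC0.
have split a : w a = w (star P * a * P) + w (star Q * a * Q).
  have PQ : P + Q = 1 by rewrite /Q addrC subrK.
  transitivity (w (star (P + Q) * a * (P + Q))).
    by rewrite PQ star1 mul1r mulr1.
  have -> X Y : star (X + Y) * a * (X + Y) =
      star X * a * X + star X * a * Y + (star Y * a * X + star Y * a * Y).
    by rewrite starD !mulrDl !mulrDr.
  by rewrite !wD cross cross' addr0 add0r.
set t := w (star P * P).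
have t1 : 1 - t = w (star Q * Q).
  by rewrite -(state1 w_state) (split 1) !mulr1 addrC addKr.
have wuPP : w (star P * u * P) = c^* * t by rewrite wuP.
(* If Q Omega = 0, the convex combination degenerates, but then Omega = P Omega is itself the
   eigenvector. *)
case: (eqVneq (w (star Q * Q)) 0) => [Q0|Qn0].
  have wQ x := state_null w_state Q0 x.
  rewrite split wuPP wQ addr0; move: t1; rewrite Q0 => /eqP; rewrite subr_eq0.
  by move=> /eqP <-; rewrite mulr1.
have t01 : 0 < t < 1.
  by rewrite lt_def Pn0 state_ge0 //= -subr_gt0 t1 lt_def Qn0 state_ge0.
have [] := pure _ _ t (vector_is_state w_state Pn0) (vector_is_state w_state Qn0) t01.
  move=> a; rewrite -/t t1 mulrCA divff // mulr1 mulrCA divff // mulr1.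
  exact: split.
move=> /(congr1 (fun f => f u)) <- _.
by rewrite wuPP mulfK.
Qed.

End PureState.

End FiniteOrder.

(** * Inequivalence *)

Section Omega.
Context {R : realType} {A : cstarAlgType R} {p : nat} (s : 'I_p.+1 -> A).
Hypothesis s_cuntz : cuntz_family s.
Implicit Types (x y : A) (w phi : A -> R[i]).

Local Notation u := (s ord_max).
Local Notation E := (gp_word s).

(* The model is phi a = <pi(a) X, Y>, with vectors X and Y that induce w1 and w2. *)
Section Coupling.
Variables (w1 w2 phi : A -> R[i]).
Hypotheses (w1_state : is_state w1) (w2_state : is_state w2).
Hypothesis phi_scalar : scalar phi.
Hypothesis phi_le : forall x y, normc (phi (star y * x)) ^+ 2 <=
  Re (w1 (star x * x)) * Re (w2 (star y * y)).

Lemma coupling_bounded : bounded_functional phi.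
Proof.
split=> //; exists 1 => a; rewrite mul1r.
rewrite -(@ler_pXn2r _ 2) ?nnegrE ?normc_ge0 ?cnorm_ge0 //.
have := phi_le a 1; rewrite star1 !mul1r state1 // mulr1 => h; apply: le_trans h _.
rewrite -cnorm_starM; apply: le_trans (Re_le_normc _) _.
by case: w1_state.
Qed.

(** Domination by the two states makes phi vanish on null vectors; this is how eigenvector relations
    pass from the states to phi. *)
Lemma couplingMr d : (forall a, w1 (a * d) = 0) -> forall a, phi (a * d) = 0.
Proof.
move=> wd a; apply: Normc.eq0_normc; apply/eqP; rewrite -sqrf_eq0 eq_le sqr_ge0 andbT.
by have := phi_le d (star a); rewrite starK wd mul0r.
Qed.

Lemma couplingMl d : (forall a, w2 (a * d) = 0) -> forall a, phi (star d * a) = 0.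
Proof.
move=> wd a; apply: Normc.eq0_normc; apply/eqP; rewrite -sqrf_eq0 eq_le sqr_ge0 andbT.
by have := phi_le a d; rewrite wd mulr0.
Qed.

Lemma coupling_eigenr v (c : R[i]) : (forall x, w1 (x * v) = c * w1 x) ->
  forall x, phi (x * v) = c * phi x.
Proof.
move=> wv x; have /couplingMr/(_ x) : forall a, w1 (a * (v - c *: 1)) = 0.
  move=> a; rewrite mulrBr -scalerAr mulr1 (functionalB (state_scalar w1_state)).
  by rewrite (functionalZ (state_scalar w1_state)) wv subrr.
rewrite mulrBr -scalerAr mulr1 (functionalB phi_scalar) (functionalZ phi_scalar).
by move=> /eqP; rewrite subr_eq0 => /eqP.
Qed.

Lemma coupling_eigenl v (c : R[i]) : (forall x, w2 (x * v) = c * w2 x) ->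
  forall x, phi (star v * x) = c^* * phi x.
Proof.
move=> wv x; have /couplingMl/(_ x) : forall a, w2 (a * (v - c *: 1)) = 0.
  move=> a; rewrite mulrBr -scalerAr mulr1 (functionalB (state_scalar w2_state)).
  by rewrite (functionalZ (state_scalar w2_state)) wv subrr.
rewrite starB starZ star1 mulrBl -scalerAl mul1r.
rewrite (functionalB phi_scalar) (functionalZ phi_scalar).
by move=> /eqP; rewrite subr_eq0 => /eqP.
Qed.

Lemma coupling_block_eq0 (z z' : nat -> 'I_p -> R[i]) :
  star_generates (range s) -> block_eigen s w1 z -> block_eigen s w2 z' ->
  tail s w1 @ \oo --> (0 : R) \/ tail s w2 @ \oo --> (0 : R) ->
  (exists r i, z r i <> z' r i) -> forall a, phi a = 0.
Proof.
move=> gen wz wz' t0 zz'.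
have hz r i x : phi (x * star (E r i)) = z r i * phi x.
  exact: coupling_eigenr (wz r i) x.
have hz' r i x : phi (E r i * x) = (z' r i)^* * phi x.
  by rewrite -{1}[E r i]starK; exact: coupling_eigenl (wz' r i) x.
have van : vanishing s phi by exact: (vanishing_of_tail s_cuntz w1_state w2_state).
apply: (vanishing_block_eq0 s_cuntz gen coupling_bounded hz hz' van).
apply: (vanishing_unit_eq0 s_cuntz phi_scalar hz hz' van) => //.
  by move=> M; exact: (block_eigen_sum_le1 s_cuntz w1_state M wz).
by move=> M; exact: (block_eigen_sum_le1 s_cuntz w2_state M wz').
Qed.

Lemma coupling_cuntz_eq0 (c c' : R[i]) : star_generates (range s) ->
  normc c = 1 -> normc c' = 1 -> w1 u = c^* -> w2 u = c'^* -> c <> c' ->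
  forall a, phi a = 0.
Proof.
move=> gen c1 c'1 wu wu' cc'.
have [h1 _ wE] := cuntz_state_block s_cuntz c1 w1_state wu.
have [h1' _ wE'] := cuntz_state_block s_cuntz c'1 w2_state wu'.
have k1 := coupling_eigenr h1.
have k2 x : phi (u * x) = c'^* * phi x by rewrite -{1}[u]starK; exact: coupling_eigenl.
have k3 x : phi (star u * x) = c' * phi x.
  rewrite -[c' in RHS]conjCK; apply: coupling_eigenl.
  exact: (isometry_eigen w2_state (star_maxK s_cuntz) wu' c'1).
have phi1 : phi 1 = 0.
  have := k3 1; rewrite mulr1 -[star u]mul1r k1 => /eqP.
  by rewrite -subr_eq0 -mulrBl mulf_eq0 subr_eq0 => /orP[/eqP//|/eqP].
apply: (block_functional_eq0 s_cuntz gen coupling_bounded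
  (z := fun _ _ => 0) (z' := fun _ _ => 0)).
- by move=> r i x; exact: coupling_eigenr (wE r i) x.
- move=> r i x; rewrite -{1}[E r i]starK (coupling_eigenl (wE' r i)).
  by rewrite conjC0.
- by move=> a b; rewrite (max_eigenX k1 k2) phi1 mulr0.
Qed.

End Coupling.

(** The default value of [omega] is 0 at 1, hence is not a state. *)
Lemma omega_state_spec (v : (nat -> R[i]) + 'rV[R[i]]_p.+1) : is_state (omega s v) ->
  match v with
  | inl z => is_gp_state_infty s z (omega s v)
  | inr y => is_cuntz_state s y (omega s v)
  end.
Proof.
rewrite /omega; case: xgetP => [w -> //|_ [_ _ _ /eqP]].
by rewrite eq_sym oner_eq0.
Qed.

Lemma omega_eq_infty z w : (0 < p)%N -> star_generates (range s) -> unit_l2 z ->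
  is_gp_state_infty s z w -> w = omega s (inl z).
Proof.
move=> p0 gen z1 wz; apply: (gp_state_infty_unique s_cuntz p0 gen z1 wz).
by rewrite /omega; case: xgetP => [w' _ //|/(_ w)].
Qed.

Lemma omega_eq_cuntz (c : R[i]) w : star_generates (range s) -> normc c = 1 ->
  is_state w -> w u = c^* ->
  w = omega s (inr (\row_j (if j == ord_max then c else 0))).
Proof.
move=> gen c1 ws wu; set y := \row_j _.
have wy : is_cuntz_state s y w.
  split=> // j; rewrite mxE; case: (max_or_widen j) => [->|[i ->]].
    by rewrite eqxx wu.
  have [_ _ wE] := cuntz_state_block s_cuntz c1 ws wu.
  rewrite widen_neq_max -(block_eigen_gp_word ws 0 i wE).
  by rewrite /gp_word expr0 mul1r.
have [ws' wy'] : is_cuntz_state s y (omega s (inr y)).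
  by rewrite /omega; case: xgetP => [w' _ //|/(_ w)].
apply: (cuntz_state_unique s_cuntz gen c1 ws ws' wu).
by rewrite wy' mxE eqxx.
Qed.

(** A Cuntz parameter acts as the zero sequence, which differs from every unit sequence. At least
    one tail tends to 0 unless both parameters are Cuntz. *)
Lemma coupling_omega_eq0 (v v' : (nat -> R[i]) + 'rV[R[i]]_p.+1) phi :
  (0 < p)%N -> star_generates (range s) -> Lambda v -> Lambda v' -> v <> v' ->
  is_state (omega s v) -> is_state (omega s v') -> scalar phi ->
  (forall x y, normc (phi (star y * x)) ^+ 2 <=
    Re (omega s v (star x * x)) * Re (omega s v' (star y * y))) ->
  forall a, phi a = 0.
Proof.
move=> p0 gen; move: v v'.
have nonzero (z : nat -> R[i]) : unit_l2 z -> exists j, z j <> 0.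
  move=> z1; apply/existsNP => z0; have : (fun=> 0 : R) @ \oo --> (1 : R).
    rewrite /unit_l2 /= in z1.
    rewrite (_ : (fun=> 0) = series (fun j => normc (z j) ^+ 2)) //.
    apply: funext => n; rewrite /series /= big1 // => j _.
    by rewrite z0 Normc.normc0 expr0n.
  move=> h; have h0 : (fun=> 0 : R) @ \oo --> (0 : R) by exact: cvg_cst.
  have /eqP : (1 : R) = 0 by exact: (cvg_unique _ h h0).
  by rewrite oner_eq0.
have block j : exists r (i : 'I_p), j = (p * r + i)%N.
  exists (j %/ p)%N, (Ordinal (ltn_pmod j p0)).
  by rewrite mulnC /= -divn_eq.
case=> [z|y] [z'|y'] /= L L' vv' ws ws' phil phile;
  move: (omega_state_spec ws) (omega_state_spec ws') => /= S S'.
- have [wz t0] := gp_state_infty_block s_cuntz p0 L S.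
  have [wz' _] := gp_state_infty_block s_cuntz p0 L' S'.
  apply: (coupling_block_eq0 ws ws' phil phile gen wz wz'); first by left.
  have [j zj] : exists j, z j <> z' j.
    by apply/existsNP => zz'; apply: vv'; congr inl; exact: funext.
  by have [r [i ji]] := block j; exists r, i; rewrite -ji.
- have [wz t0] := gp_state_infty_block s_cuntz p0 L S.
  have [c [c1 yc]] := L'; have [_ wu'] := S'.
  have [|_ _ wz'] := cuntz_state_block s_cuntz c1 ws'.
    by rewrite wu' yc mxE eqxx.
  apply: (coupling_block_eq0 ws ws' phil phile gen wz wz'); first by left.
  have [j zj] := nonzero z L.
  by have [r [i ji]] := block j; exists r, i; rewrite -ji.
- have [wz' t0] := gp_state_infty_block s_cuntz p0 L' S'.
  have [c [c1 yc]] := L; have [_ wu] := S.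
  have [|_ _ wz] := cuntz_state_block s_cuntz c1 ws.
    by rewrite wu yc mxE eqxx.
  apply: (coupling_block_eq0 ws ws' phil phile gen wz wz'); first by right.
  have [j zj] := nonzero z' L'.
  by have [r [i ji]] := block j; exists r, i; rewrite -ji => /esym.
- have [c [c1 yc]] := L; have [c' [c'1 yc']] := L'.
  have [_ wu] := S; have [_ wu'] := S'.
  apply: (coupling_cuntz_eq0 ws ws' phil phile gen c1 c'1).
  + by rewrite wu yc mxE eqxx.
  + by rewrite wu' yc' mxE eqxx.
  + by move=> cc'; apply: vv'; rewrite yc yc' cc'.
Qed.

End Omega.

(** * Orthogonality to a dense set *)

Section Hilbert.
Context {R : realType} {H : hilbertType R}.
Implicit Types (x y : H).

Lemma dot_scalar y : scalar (dot^~ y).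
Proof. by move=> c x x'; rewrite /= dotDl dotZl. Qed.

Lemma dot_ge0 x : 0 <= dot x x.
Proof. by rewrite dotE exprn_ge0. Qed.

(** Otherwise some x in S has |y - x| < |y|, whereas orthogonality gives |y - x|^2 = |y|^2 +
    |x|^2. *)
Lemma dense_orthogonal_eq0 (S : set H) y : dense S ->
  (forall x, S x -> dot x y = 0) -> y = 0.
Proof.
move=> Sd Sy; apply/eqP; rewrite -normr_eq0; apply/negPn/negP => yn.
have y0 : 0 < `|y| by rewrite lt_def yn normr_ge0.
have [||x [/= yx Sx]] := Sd (ball y `|y|); first by exists y; exact: ballxx.
  exact: ball_open.
move: yx; rewrite -ball_normE /= => yx.
have : `|y - x| ^+ 2 < `|y| ^+ 2 by rewrite ltrXn2r ?normr_ge0.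
have dBl (a b c : H) : dot (a - b) c = dot a c - dot b c.
  exact: (functionalB (dot_scalar c)).
have dBr (a b c : H) : dot c (a - b) = dot c a - dot c b.
  by rewrite [LHS]dotC dBl rmorphB /= -!dotC.
have xy0 := Sy x Sx; have yx0 : dot y x = 0 by rewrite dotC xy0 conjC0.
rewrite -!dotE dBl !dBr xy0 yx0 subr0 sub0r opprK gtrDl.
by move=> /(le_lt_trans (dot_ge0 x)); rewrite ltxx.
Qed.

End Hilbert.

Theorem mainTheorem10 (R : realType) (p : nat) (hn : (2 <= p.+1)%N)
    (A : cstarAlgType R) (s : 'I_p.+1 -> A) (hA : is_cuntz_algebra s) :
  (forall w : A -> R[i],
     is_pure_state w -> is_geometric_progression_state s w ->
     exists2 v, Lambda v & w = omega s v) /\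
  (forall v v' : (nat -> R[i]) + 'rV[R[i]]_p.+1,
     Lambda v -> Lambda v' -> v <> v' ->
     forall (H H' : hilbertType R) (pi : A -> H -> H) (pi' : A -> H' -> H')
       (Omega : H) (Omega' : H'),
     is_GNS (omega s v) pi Omega -> is_GNS (omega s v') pi' Omega' ->
     ~ unitarily_equivalent pi pi').
Proof.
have [s_cuntz s_gen _] := hA; have p0 : (0 < p)%N by [].
split=> [w wp|v v' Lv Lv' vv' H H' pi pi' X X' [ws _ wX Xd] [ws' rho wX' _]
  [U [Ub Ud UpI]]].
  have ws := wp.1; case=> [[k [z [k0 z1 wz]]]|[z z1 wz]]; last first.
    by exists (inl z) => //; exact: omega_eq_infty.
  have := unit_row_max_le1 z1; rewrite le_eqVlt => /orP[/eqP zeta1|zeta1].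
    have [_ wk] := gp_state_block s_cuntz z1 wz.
    have [c c1 wu] := pure_state_max_eigen s_cuntz ws k0 zeta1 wk s_gen wp.
    exists (inr (\row_j (if j == ord_max then c else 0))); first by exists c.
    exact: omega_eq_cuntz.
  have [z' z'1 wz'] := gp_state_unit_infty s_cuntz p0 k0 z1 wz zeta1.
  by exists (inl z') => //; exact: omega_eq_infty.
have [_ rhoD rhoM rho1 rhoS] := rho.
(* The intertwiner carries X to a vector of the second space, so both states are vector states of
   [pi']. *)
have wU a : omega s v a = dot (pi' a (U X)) (U X) by rewrite wX -Ud UpI.
pose phi a := dot (pi' a (U X)) X'.
have phi0 : forall a, phi a = 0.
  apply: (coupling_omega_eq0 s_cuntz p0 s_gen Lv Lv' vv' ws ws').
    by move=> c a b; rewrite /phi rhoD dot_scalar.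
  move=> a b; rewrite wU wX' /phi !rhoM !rhoS.
  exact: (cauchy_schwarz dot_scalar dotC dot_ge0).
have [V VU UV] := Ub.
(* Pulled back by the unitary, X' is orthogonal to the dense set of the [pi a X]. *)
have VX' : V X' = 0.
  apply: (dense_orthogonal_eq0 Xd) => _ [a _ <-].
  by rewrite -Ud UpI UV; exact: phi0.
(* Now X' = 0, although the state it induces has value 1 at 1. *)
have [_ _ _ w1] := ws'; have := w1.
rewrite wX' rho1 -[X']UV VX' linear0 (functional0 (dot_scalar _)) => /eqP.
by rewrite eq_sym oner_eq0.
Qed.
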